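(* There is an algorithm that, given a finite digraph $G_0$, a weight function $w\colon A_{G_0}\to\mathbb{R}$ and a rainbow matroid $\mathcal{M}_V$ on $V_{G_0}$ (given by a coloring of the nodes), finds a matroid branching $B$ in $G_0$ with respect to $\mathcal{M}_V$ that has minimum weight $w(B)$ among all matroid branchings of maximum cardinality $|B|$, and runs in $O(n^2)$ time, where $n:=|V_G|$ is the number of nodes of the augmented digraph $G$ obtained from $G_0$ by adding an auxiliary node $s$ and an arc $(s,v)$ for every $v\in V_{G_0}$.
   Context: A digraph $G_0$ has a finite nonempty node set $V_{G_0}$ and an arc set $A_{G_0}\subseteq V_{G_0}\times V_{G_0}$ (no parallel arcs). A branching is a set $B$ of arcs such that the underlying undirected graph spanned by $B$ is acyclic and each node is entered (covered) by at most one arc of $B$; $C(B)$ denotes the set of nodes entered by an arc of $B$. A rainbow matroid on $V_{G_0}$ is given by a partition of $V_{G_0}$ into color classes; a set of nodes is independent iff it contains at most one node of each color (equivalently, it is a direct sum of matroids whose independent sets are the empty set and the singletons). A matroid branching w.r.t. $\mathcal{M}_V$ is a branching $B$ such that $C(B)$ is independent w.r.t. $\mathcal{M}_V$. The weight of $B$ is $w(B):=\sum_{a\in B}w(a)$. Time is counted in elementary operations, with arithmetic operations and comparisons on real numbers taking unit time. *)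

(* Defs.v *)
From mathcomp Require Import all_boot all_order all_algebra.
From mathcomp Require Import reals.

Set Implicit Arguments.
Unset Strict Implicit.
Unset Printing Implicit Defensive.

Import Order.TTheory GRing.Theory Num.Theory.
Local Open Scope ring_scope.

(* Loops and antiparallel pairs of arcs are allowed; the arc (u, v) leaves u
   and enters v. *)
Record digraph := Digraph {
  node : finType;
  arcs : {set node * node};
  node_gt0 : (0 < #|node|)%N }.

(* The auxiliary node s is None. *)
Definition augment_arcs (G : digraph) : {set option (node G) * option (node G)} :=
  [set (Some a.1, Some a.2) | a in arcs G] :|: [set (None, Some v) | v : node G].

Lemma augment_gt0 (G : digraph) : (0 < #|{: option (node G)}|)%N.
Proof. by rewrite card_option. Qed.

Definition augment (G : digraph) : digraph :=
  @Digraph (option (node G)) (augment_arcs G) (augment_gt0 G).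

Section Branchings.
Variable V : finType.
Implicit Types (B : {set V * V}) (X : {set V}) (a : V * V).

Definition joins a (u v : V) : bool := (a == (u, v)) || (a == (v, u)).

(* A cycle of the underlying undirected multigraph is a cyclic sequence of pairs
   (a_i, v_i) with distinct arcs and distinct nodes, where a_i joins v_i and
   v_(i+1), in either direction.  Length 1 is a loop, and length 2 is a pair of
   antiparallel arcs, which are two parallel edges of the undirected graph. *)
Definition undirected_cycle B (c : seq ((V * V) * V)) : bool :=
  [&& c != [::], uniq (unzip1 c), uniq (unzip2 c), all (mem B) (unzip1 c)
    & cycle (fun x y => joins x.1 x.2 y.2) c].

Definition undirected_acyclic B : Prop := forall c, ~~ undirected_cycle B c.

Definition branching (A B : {set V * V}) : Prop :=
  [/\ B \subset A, undirected_acyclic B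
    & forall v : V, (#|[set a in B | a.2 == v]| <= 1)%N].

Definition covered B : {set V} := [set a.2 | a in B].

Definition rainbow_indep (color : V -> nat) X : Prop :=
  forall k : nat, (#|[set v in X | color v == k]| <= 1)%N.

Definition matroid_branching (A : {set V * V}) (color : V -> nat) B : Prop :=
  branching A B /\ rainbow_indep color (covered B).

Definition max_matroid_branching (A : {set V * V}) (color : V -> nat) B : Prop :=
  matroid_branching A color B /\
  (forall B', matroid_branching A color B' -> (#|B'| <= #|B|)%N).

Definition weight (R : realType) (w : V * V -> R) B : R := \sum_(a in B) w a.

Definition min_weight_max_matroid_branching (R : realType)
    (A : {set V * V}) (w : V * V -> R) (color : V -> nat) B : Prop :=
  max_matroid_branching A color B /\
  (forall B', max_matroid_branching A color B' -> weight w B <= weight w B').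

End Branchings.

(* A real random access machine programmed by structured programs.  The memory
   consists of two-dimensional arrays, of natural numbers and of real numbers;
   a program mentions finitely many arrays, by fixed names, while the indices
   are computed.  Real numbers can only be combined by field operations and
   compared.  There is no multiplication of natural numbers, so that in t steps
   they grow by at most t doublings, as in the usual unit-cost machine with
   addition and subtraction. *)
Inductive nexpr : Type :=
| NConst of nat
| NGet of nat & nexpr & nexpr
| NAdd of nexpr & nexpr
| NSub of nexpr & nexpr.

Inductive rexpr : Type :=
| RConst of nat
| RGet of nat & nexpr & nexpr
| RAdd of rexpr & rexpr
| RSub of rexpr & rexpr
| RMul of rexpr & rexpr
| RDiv of rexpr & rexpr.

Inductive bexpr : Type :=
| NEq of nexpr & nexpr
| NLe of nexpr & nexpr
| REq of rexpr & rexpr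
| RLe of rexpr & rexpr
| BNot of bexpr
| BAnd of bexpr & bexpr.

Inductive program : Type :=
| Skip
| NSet of nat & nexpr & nexpr & nexpr
| RSet of nat & nexpr & nexpr & rexpr
| Seq of program & program
| If of bexpr & program & program
| While of bexpr & program.

(* Unit cost: one elementary operation for each constant, memory access,
   arithmetic operation, comparison and connective. *)
Fixpoint ncost (e : nexpr) : nat :=
  match e with
  | NConst _ => 1
  | NGet _ e1 e2 | NAdd e1 e2 | NSub e1 e2 => (ncost e1 + ncost e2).+1
  end.

Fixpoint rcost (e : rexpr) : nat :=
  match e with
  | RConst _ => 1
  | RGet _ e1 e2 => (ncost e1 + ncost e2).+1
  | RAdd e1 e2 | RSub e1 e2 | RMul e1 e2 | RDiv e1 e2 => (rcost e1 + rcost e2).+1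
  end.

Fixpoint bcost (b : bexpr) : nat :=
  match b with
  | NEq e1 e2 | NLe e1 e2 => (ncost e1 + ncost e2).+1
  | REq e1 e2 | RLe e1 e2 => (rcost e1 + rcost e2).+1
  | BNot b1 => (bcost b1).+1
  | BAnd b1 b2 => (bcost b1 + bcost b2).+1
  end.

Section Semantics.
Variable R : realType.

Record state := State {
  nmem : nat -> nat -> nat -> nat;
  rmem : nat -> nat -> nat -> R }.

Definition update (T : Type) (m : nat -> nat -> nat -> T) (x i j : nat) (t : T)
    : nat -> nat -> nat -> T :=
  fun x' i' j' => if [&& x' == x, i' == i & j' == j] then t else m x' i' j'.

Fixpoint neval (st : state) (e : nexpr) : nat :=
  match e with
  | NConst k => k
  | NGet x e1 e2 => nmem st x (neval st e1) (neval st e2)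
  | NAdd e1 e2 => (neval st e1 + neval st e2)%N
  | NSub e1 e2 => (neval st e1 - neval st e2)%N
  end.

Fixpoint reval (st : state) (e : rexpr) : R :=
  match e with
  | RConst k => k%:R
  | RGet x e1 e2 => rmem st x (neval st e1) (neval st e2)
  | RAdd e1 e2 => reval st e1 + reval st e2
  | RSub e1 e2 => reval st e1 - reval st e2
  | RMul e1 e2 => reval st e1 * reval st e2
  | RDiv e1 e2 => reval st e1 / reval st e2
  end.

Fixpoint beval (st : state) (b : bexpr) : bool :=
  match b with
  | NEq e1 e2 => neval st e1 == neval st e2
  | NLe e1 e2 => (neval st e1 <= neval st e2)%N
  | REq e1 e2 => reval st e1 == reval st e2
  | RLe e1 e2 => reval st e1 <= reval st e2
  | BNot b1 => ~~ beval st b1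
  | BAnd b1 b2 => beval st b1 && beval st b2
  end.

(* [exec p st t st'] : started in st, the program p terminates in st' after
   exactly t elementary operations. *)
Inductive exec : program -> state -> nat -> state -> Prop :=
| exec_skip st : exec Skip st 1 st
| exec_nset st x e1 e2 e :
    exec (NSet x e1 e2 e) st (ncost e1 + ncost e2 + ncost e).+1
      (State (update (nmem st) x (neval st e1) (neval st e2) (neval st e)) (rmem st))
| exec_rset st x e1 e2 e :
    exec (RSet x e1 e2 e) st (ncost e1 + ncost e2 + rcost e).+1
      (State (nmem st) (update (rmem st) x (neval st e1) (neval st e2) (reval st e)))
| exec_seq p q st st1 st2 t1 t2 :
    exec p st t1 st1 -> exec q st1 t2 st2 ->
    exec (Seq p q) st (t1 + t2) st2
| exec_if b p q st st' t :
    exec (if beval st b then p else q) st t st' ->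
    exec (If b p q) st (bcost b + t).+1 st'
| exec_while_false b p st :
    ~~ beval st b -> exec (While b p) st (bcost b).+1 st
| exec_while_true b p st st1 st2 t1 t2 :
    beval st b -> exec p st t1 st1 -> exec (While b p) st1 t2 st2 ->
    exec (While b p) st (bcost b + t1 + t2).+1 st2.

End Semantics.

(* Input and output format.  The nodes are numbered from 0 by [enum_rank].
   Initially, natural-number array 0 holds the number of nodes in cell (0, 0),
   array 1 is the adjacency matrix, array 2 holds the color of node i in cell
   (i, 0), and real array 0 holds the arc weights; every other cell is 0, so the
   values of w outside the arc set are not visible to the program.  On
   termination, the nonzero cells of natural-number array 3 are the computed
   arcs. *)
Section InputOutput.
Variables (R : realType) (G : digraph).

Definition node_at (i : nat) : option (node G) :=
  [pick v | enum_rank v == i :> nat].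

Definition arc_at (i j : nat) : option (node G * node G) :=
  if (node_at i, node_at j) is (Some u, Some v) then
    if (u, v) \in arcs G then Some (u, v) else None
  else None.

Definition input (w : node G * node G -> R) (color : node G -> nat) : state R :=
  State
    (fun x i j =>
       match x with
       | 0 => if (i == 0) && (j == 0) then #|node G| else 0
       | 1 => if arc_at i j is Some _ then 1 else 0
       | 2 => if (node_at i, j) is (Some v, 0) then color v else 0
       | _ => 0
       end%N)
    (fun x i j => if (x, arc_at i j) is (0%N, Some a) then w a else 0).

Definition output (st : state R) : {set node G * node G} :=
  [set a | nmem st 3 (enum_rank a.1) (enum_rank a.2) != 0%N].

End InputOutput.

(* Main.v *)
Require Import Defs.
From mathcomp Require Import all_boot all_order all_algebra.
From mathcomp Require Import reals.
From mathcomp Require Import zify lra.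

(* The program is the contraction algorithm of Edmonds for arborescences, with
   color classes in the role of nodes.  A source s, numbered n, is joined to
   every node and the digraph is completed; with M > 2 * sum |w|, the arcs of the
   digraph get weight w + M >= 0 and all other arcs weight 2 M.  Then one looks
   for a cheapest acyclic set with exactly one arc entering every color class, and
   its arcs of the original digraph form the desired branching.

   A class that has not selected an arc selects a cheapest arc, with respect to
   reduced weights, among those entering it and not joining two nodes of one
   supernode.  If the selected arcs now contain a cycle of supernodes, these are
   merged into one supernode and their classes into one class, which has to
   select again.  Every selection is an event.  Going back through the events,
   the arc of an event is chosen unless an arc entering the class of the event
   has already been chosen.

   The sum L of the reduced weights of the selected arcs is both the weight of the
   result and a lower bound: a class with k colors has k - 1 more nodes than
   supernodes, so at most k - 1 arcs of an acyclic set lie inside its supernodes,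
   and a set with one arc for each color has an arc entering the class that joins
   distinct supernodes.  A phase that merges d supernodes takes time O(n (d + 1)),
   since the best arc from every node into every supernode is maintained. *)

Set Implicit Arguments.
Unset Strict Implicit.
Unset Printing Implicit Defensive.

Import Order.TTheory GRing.Theory Num.Theory.

(** * Programs and their running time *)

(** All candidate sets have one arc per color, hence the same size, so up to a constant the cost of
    a set with real arcs [B] is [w(B) - |B| M]. Two weights differ by less than [M], so cardinality
    is compared before weight. The difference from arborescences is that a class may own several
    supernodes, of which its selected arc enters only one. A cycle therefore merges whole classes
    but one supernode of each, and tracing selected arcs backwards may stop at a supernode that no
    arc enters. Acyclicity is always witnessed by a rank increasing along arcs and, during the
    contraction, constant on supernodes, so that opening or merging a cycle or adding an arc amounts
    to giving a new rank. This agrees with undirected acyclicity because each node is entered at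
    most once. The quadratic bound comes from a potential, the number of supernodes plus that of
    unselected classes, which is at most [2 n]: a selection removes an unselected class, and merging
    [d] supernodes removes [d - 1] of them and restores at most one unselected class. *)

Definition scal (x : nat) : nexpr := NGet x (NConst 0) (NConst 0).
Definition vec (x : nat) (e : nexpr) : nexpr := NGet x e (NConst 0).
Definition set_scal (x : nat) (e : nexpr) : program := NSet x (NConst 0) (NConst 0) e.
Definition set_vec (x : nat) (i e : nexpr) : program := NSet x i (NConst 0) e.

Definition nlt (e1 e2 : nexpr) : bexpr := NLe (NAdd e1 (NConst 1)) e2.
Definition rlt (e1 e2 : rexpr) : bexpr := BNot (RLe e2 e1).
Definition nneq (e1 e2 : nexpr) : bexpr := BNot (NEq e1 e2).

Definition for_loop (i : nat) (e : nexpr) (p : program) : program :=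
  Seq (set_scal i (NConst 0))
      (While (nlt (scal i) e) (Seq p (set_scal i (NAdd (scal i) (NConst 1))))).

Fixpoint straight (p : program) : bool :=
  match p with
  | Seq p q | If _ p q => straight p && straight q
  | While _ _ => false
  | _ => true
  end.

(** Adding up both branches of a conditional loses only a constant. The value 0 for loops is a
    dummy, since [straight] excludes them. *)
Fixpoint cost_bound (p : program) : nat :=
  match p with
  | Skip => 1
  | NSet _ e1 e2 e => (ncost e1 + ncost e2 + ncost e).+1
  | RSet _ e1 e2 e => (ncost e1 + ncost e2 + rcost e).+1
  | Seq p q => cost_bound p + cost_bound q
  | If b p q => (bcost b + (cost_bound p + cost_bound q)).+1
  | While _ _ => 0
  end.

Fixpoint modn (p : program) : seq nat :=
  match p with
  | NSet x _ _ _ => [:: x]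
  | Seq p q | If _ p q => modn p ++ modn q
  | While _ p => modn p
  | _ => [::]
  end.

Fixpoint modr (p : program) : seq nat :=
  match p with
  | RSet x _ _ _ => [:: x]
  | Seq p q | If _ p q => modr p ++ modr q
  | While _ p => modr p
  | _ => [::]
  end.

Section Logic.
Variable R : realType.
Implicit Types (st : state R) (p q : program).

Definition nset st x i j k : state R := State (update (nmem st) x i j k) (rmem st).

Fixpoint run p st : state R :=
  match p with
  | NSet x e1 e2 e =>
      State (update (nmem st) x (neval st e1) (neval st e2) (neval st e)) (rmem st)
  | RSet x e1 e2 e =>
      State (nmem st) (update (rmem st) x (neval st e1) (neval st e2) (reval st e))
  | Seq p q => run q (run p st)
  | If b p q => if beval st b then run p st else run q st
  | _ => st
  end.

Lemma exec_run p st : straight p ->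
  exists2 t, exec p st t (run p st) & t <= cost_bound p.
Proof.
elim: p st => [|x e1 e2 e|x e1 e2 e|p IHp q IHq|b p IHp q IHq|b p IHp] //= st.
- by move=> _; exists 1 => //; constructor.
- by move=> _; eexists; [constructor|].
- by move=> _; eexists; [constructor|].
- case/andP=> hp hq; have [t1 e1 l1] := IHp st hp; have [t2 e2 l2] := IHq (run p st) hq.
  by exists (t1 + t2); [apply: exec_seq e1 e2 | apply: leq_add].
- case/andP=> hp hq; have [t1 e1 l1] := IHp st hp; have [t2 e2 l2] := IHq st hq.
  have [b1|b0] := boolP (beval st b).
    exists (bcost b + t1).+1; first by constructor; rewrite b1.
    by rewrite ltnS leq_add2l (leq_trans l1) ?leq_addr.
  exists (bcost b + t2).+1; first by constructor; rewrite (negbTE b0).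
  by rewrite ltnS leq_add2l (leq_trans l2) ?leq_addl.
Qed.

Definition frame p st st' : Prop :=
  (forall x, x \notin modn p -> nmem st' x = nmem st x) /\
  (forall x, x \notin modr p -> rmem st' x = rmem st x).

Lemma exec_frame p st t st' : exec p st t st' -> frame p st st'.
Proof.
elim=> {p st t st'} //=.
- by move=> st x e1 e2 e; split=> //= y; rewrite inE /update => /negbTE->.
- by move=> st x e1 e2 e; split=> //= y; rewrite inE /update => /negbTE->.
- move=> p q st st1 st2 t1 t2 _ [n1 r1] _ [n2 r2].
  by split=> x /=; rewrite mem_cat negb_or => /andP[h1 h2];
    rewrite ?n2 ?n1 ?r2 ?r1.
- move=> b p q st st' t _; case: (beval st b) => -[n1 r1];
  by split=> x /=; rewrite mem_cat negb_or => /andP[h1 h2]; rewrite ?n1 ?r1.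
- move=> b p st st1 st2 t1 t2 _ _ [n1 r1] _ [n2 r2].
  by split=> x /= h; rewrite ?n2 ?n1 ?r2 ?r1.
Qed.

(* The postcondition also sees the running time, which amortized bounds need. *)
Definition wpt p (Q : nat -> state R -> Prop) st : Prop :=
  exists t st', exec p st t st' /\ Q t st'.

Definition wp p (T : nat) (Q : state R -> Prop) st : Prop :=
  wpt p (fun t st' => t <= T /\ Q st') st.

Lemma wpt_weaken p (Q Q' : nat -> state R -> Prop) st :
  wpt p Q st -> (forall t st', frame p st st' -> Q t st' -> Q' t st') -> wpt p Q' st.
Proof.
by move=> [t [st' [e q]]] QQ'; exists t, st'; split=> //; apply: QQ' => //; apply: exec_frame e.
Qed.

Lemma wp_weaken p T T' (Q Q' : state R -> Prop) st :
  wp p T Q st -> T <= T' -> (forall st', frame p st st' -> Q st' -> Q' st') ->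
  wp p T' Q' st.
Proof.
move=> h lT QQ'; apply: wpt_weaken h _ => t st' fr [tT q].
by split; [apply: leq_trans lT | apply: QQ'].
Qed.

(** Only the bound [T] on the time of [p] survives, while the exact time of [q] stays visible to
    [Q]; a phase can thus keep a cost that depends on its final state. *)
Lemma wpt_seq p q T (Q1 : state R -> Prop) (Q : nat -> state R -> Prop) st :
  wp p T Q1 st ->
  (forall st1, frame p st st1 -> Q1 st1 ->
    wpt q (fun t st' => forall t1, t1 <= T -> Q (t1 + t) st') st1) ->
  wpt (Seq p q) Q st.
Proof.
move=> [t1 [st1 [e1 [l1 q1]]]] /(_ st1 (exec_frame e1) q1) [t2 [st2 [e2 q2]]].
by exists (t1 + t2), st2; split; [apply: exec_seq e1 e2 | apply: q2].
Qed.

Lemma wp_seq p q T1 T2 T (Q1 Q : state R -> Prop) st :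
  wp p T1 Q1 st -> (forall st1, frame p st st1 -> Q1 st1 -> wp q T2 Q st1) ->
  T1 + T2 <= T -> wp (Seq p q) T Q st.
Proof.
move=> h1 h2 lT; apply: wpt_seq h1 _ => st1 fr q1.
have {h2} [t2 [st2 [e2 [l2 q2]]]] := h2 st1 fr q1.
by exists t2, st2; split=> // t1 l1; split=> //; apply: leq_trans lT; apply: leq_add.
Qed.

Lemma wp_run p T (Q : state R -> Prop) st :
  straight p -> cost_bound p <= T -> Q (run p st) -> wp p T Q st.
Proof.
move=> /(@exec_run p st) [t e l] lT q; exists t, (run p st); split=> //.
by split=> //; apply: leq_trans lT.
Qed.

Lemma wpt_if b p q (Q : nat -> state R -> Prop) st :
  (beval st b -> wpt p (fun t st' => Q (bcost b + t).+1 st') st) ->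
  (~~ beval st b -> wpt q (fun t st' => Q (bcost b + t).+1 st') st) ->
  wpt (If b p q) Q st.
Proof.
move=> h1 h2; have [b1|b0] := boolP (beval st b).
  have [t [st' [e h]]] := h1 b1; exists (bcost b + t).+1, st'; split=> //.
  by constructor; rewrite b1.
have [t [st' [e h]]] := h2 b0; exists (bcost b + t).+1, st'; split=> //.
by constructor; rewrite (negbTE b0).
Qed.

Lemma wp_seq_run p q T2 T (Q : state R -> Prop) st :
  straight p ->
  (forall st1, frame p st st1 -> st1 = run p st -> wp q T2 Q st1) ->
  cost_bound p + T2 <= T -> wp (Seq p q) T Q st.
Proof.
move=> sp h; apply: (@wp_seq _ _ (cost_bound p) _ _ (fun st1 => st1 = run p st)) => //.
exact: wp_run.
Qed.

Lemma wp_if b p q T T' (Q : state R -> Prop) st :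
  (beval st b -> wp p T Q st) -> (~~ beval st b -> wp q T Q st) ->
  (bcost b + T).+1 <= T' -> wp (If b p q) T' Q st.
Proof.
move=> h1 h2 lT; apply: wpt_if => h; [have h3 := h1 h | have h3 := h2 h];
apply: wpt_weaken h3 _ => t st' _ [l ?]; split=> //;
by apply: leq_trans lT; rewrite ltnS leq_add2l.
Qed.

(* [k] is a potential that pays for the running time. *)
Lemma wp_while b p (I : nat -> state R -> Prop) A k st :
  (forall k st, I k st -> beval st b ->
    wpt p (fun t st' => exists k', [/\ k' < k, t <= A * (k - k') & I k' st']) st) ->
  I k st ->
  wp (While b p) ((A + bcost b + 1) * k + bcost b + 1)
     (fun st' => ~~ beval st' b /\ exists k', I k' st') st.
Proof.
move=> body; elim/ltn_ind: k st => k IH st Ik; have [b1|b0] := boolP (beval st b); last first.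
  exists (bcost b).+1, st; split; first exact: exec_while_false.
  by split; [lia | split=> //; exists k].
have [t1 [st1 [e1 [k1 [lk lt I1]]]]] := body _ _ Ik b1.
have [t2 [st2 [e2 [l2 q2]]]] := IH _ lk _ I1.
exists (bcost b + t1 + t2).+1, st2; split; first exact: exec_while_true e1 e2.
split=> //; move: (bcost b) lt l2 lk => c; nia.
Qed.

(** Per round, 15 is made up of the test (6 besides [ncost e]), the loop step (1) and the increment
    (8). The bound [e] is evaluated anew in each round, so its value has to persist. *)
Lemma wp_for i e p (I : nat -> state R -> Prop) N T T' st :
  i \notin modn p ->
  I 0 (nset st i 0 0 0) ->
  (forall k st, k <= N -> I k st -> neval st e = N) ->
  (forall k st, k < N -> I k st -> nmem st i 0 0 = k ->
    wp p T (fun st' => I k.+1 (nset st' i 0 0 k.+1)) st) ->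
  N * (T + ncost e + 15) + ncost e + 15 <= T' ->
  wp (for_loop i e p) T' (I N) st.
Proof.
move=> iP I0 eN body lT.
apply: (@wp_seq _ _ 4 (N * (T + ncost e + 15) + ncost e + 7) _
  (fun st1 => I 0 st1 /\ nmem st1 i 0 0 = 0)); last by lia.
  by apply: wp_run => //=; split=> //; rewrite /update /= !eqxx.
move=> st1 _ I1.
pose J k st := exists l, [/\ k = N - l, l <= N, I l st & nmem st i 0 0 = l].
have J1 : J N st1 by exists 0; case: I1 => *; split=> //; lia.
have := @wp_while (nlt (scal i) e) (Seq p (set_scal i (NAdd (scal i) (NConst 1)))) J (T + 8) N st1.
case=> //.
  move=> k {J1 I1} st2 [l [kE lN Il il]] /=; rewrite il (eN l) // => lt.
  have lt' : l < N by lia.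
  apply: wpt_seq (body l st2 lt' Il il) _ => st3 [fr _] I3.
  exists 8; eexists; split.
    by apply: exec_nset.
  move=> t1 lt1 /=; exists (N - l.+1); split; [lia| nia |].
  by exists l.+1; split=> //=; rewrite fr // il addn1 // /update /= !eqxx.
move=> t [st2 [e2 [l2 [nb [k' [l [k'E lN Il il]]]]]]].
exists t, st2; split=> //; split; first by move: l2 => /=; lia.
suff -> : N = l by [].
by move: nb => /=; rewrite il (eN l) //; lia.
Qed.

Lemma frame_trans p st1 st2 st3 : frame p st1 st2 -> frame p st2 st3 -> frame p st1 st3.
Proof. by move=> [n1 r1] [n2 r2]; split=> x h; rewrite ?n2 ?r2 ?n1 ?r1. Qed.

Lemma frame_seq p q st1 st2 st3 : frame p st1 st2 -> frame q st2 st3 ->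
  frame (Seq p q) st1 st3.
Proof.
move=> [n1 r1] [n2 r2]; split=> x; rewrite mem_cat negb_or => /andP[h1 h2].
  by rewrite n2 // n1.
by rewrite r2 // r1.
Qed.

Lemma frame_nset p st x i j k : x \in modn p -> frame p st (nset st x i j k).
Proof.
move=> xp; split=> // y yp /=; rewrite /update.
by have /negbTE-> : y != x by apply: contraNneq yp => ->.
Qed.

Lemma frame_for i e p st st' : frame p st st' -> frame (for_loop i e p) st st'.
Proof.
move=> [n1 r1]; split=> x /=; rewrite ?inE ?mem_cat !negb_or => h; last by apply: r1; case/andP: h.
by apply: n1; case/and3P: h.
Qed.

(** The frame refers to the state before the loop, so inside the body every array that the loop does
    not write can be read off the initial state. *)
Lemma wp_for_frame i e p (I : nat -> state R -> Prop) N T T' st :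
  i \notin modn p ->
  I 0 (nset st i 0 0 0) ->
  (forall st', frame (for_loop i e p) st st' -> neval st' e = N) ->
  (forall k st', k < N -> frame (for_loop i e p) st st' -> I k st' -> nmem st' i 0 0 = k ->
    wp p T (fun st'' => I k.+1 (nset st'' i 0 0 k.+1)) st') ->
  N * (T + ncost e + 15) + ncost e + 15 <= T' ->
  wp (for_loop i e p) T' (I N) st.
Proof.
move=> iP I0 eN body lT.
have imod : i \in modn (for_loop i e p) by rewrite /= mem_head.
have := @wp_for i e p (fun k st' => I k st' /\ frame (for_loop i e p) st st') N T T' st iP.
move=> h; apply: (wp_weaken (h _ _ _ lT)) => [||k st' kN [Ik fr] ik|//|st' _ []//].
- by split=> //; apply: frame_nset.
- by move=> k st' _ [_ /eN].
apply: wp_weaken (body k st' kN fr Ik ik) _ _ => // st'' /(frame_for i e) fr' Ik'.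
split=> //; apply: (frame_trans fr); apply: (frame_trans fr'); exact: frame_nset.
Qed.

End Logic.

(** * Contraction of classes and supernodes *)

Section Contraction.
Variables (R : realType) (n : nat) (W : nat -> nat -> R).

Local Notation arc := (nat * nat)%type.

(* The arc selected by class [k] leaves the node [selx k] (the source is the node
   [n]) and enters the supernode [selT k]; [off v] is the total reduced weight of
   the arcs selected so far by the classes of [v]. *)
Record config := Config {
  cls : nat -> nat;
  rep : nat -> nat;
  sel : pred nat;
  selx : nat -> nat;
  selT : nat -> nat;
  off : nat -> R }.

Definition is_arc (a : arc) : bool := (a.1 <= n) && (a.2 < n).
Definition red (S : config) (a : arc) : R := (W a.1 a.2 - off S a.2)%R.
Definition active (S : config) (a : arc) : bool := rep S a.1 != rep S a.2.
Definition hcls (S : config) (F : seq arc) : seq nat := [seq cls S a.2 | a <- F].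

Definition rep_compat (S : config) (r : nat -> nat) : Prop :=
  forall u v, u <= n -> v <= n -> rep S u = rep S v -> r u = r v.

(* [F] consists of the arcs chosen on the way back through the events, and a
   selected class without an arc in [F] will keep its selected arc; the rank
   excludes cycles of supernodes. *)
Definition sol_rank (S : config) (F : seq arc) (r : nat -> nat) : Prop :=
  [/\ rep_compat S r,
      forall a, a \in F -> is_arc a /\ r a.1 < r a.2,
      uniq (hcls S F) &
      forall u, u < n ->
        if sel S (cls S u) then
          cls S u \notin hcls S F -> r (selx S (cls S u)) < r (selT S (cls S u))
        else cls S u \in hcls S F].

Definition partial_sol (S : config) (F : seq arc) : Prop := exists r, sol_rank S F r.

Definition cost (F : seq arc) : R := (\sum_(a <- F) W a.1 a.2)%R.

(** The predicate records the nodes of the class at the time of the selection, because later merges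
    enlarge the class. In a history the newest event comes first. *)
Definition event := (pred nat * arc)%type.

Fixpoint expand (H : seq event) (F : seq arc) : seq arc :=
  if H is e :: H' then
    expand H' (if has (fun a => e.1 a.2) F then F else e.2 :: F)
  else F.

Record wf (S : config) : Prop := Wf {
  rep_n : rep S n = n;
  rep_lt : forall u, u < n -> rep S u < n;
  rep_idem : forall u, u < n -> rep S (rep S u) = rep S u;
  cls_rep : forall u, u < n -> cls S (rep S u) = cls S u;
  sel_wf : forall u, u < n -> sel S (cls S u) ->
    [/\ selx S (cls S u) <= n, selT S (cls S u) < n,
        cls S (selT S (cls S u)) = cls S u
      & rep S (selT S (cls S u)) = selT S (cls S u)] }.

Definition nonrep (S : config) (k : nat) : nat :=
  count (fun v => (cls S v == k) && (rep S v != v)) (iota 0 n).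

(** [inv_count] forces an active arc of every solution into every class. Only active arcs occur in
    [inv_red] and [inv_lower], since reduced weights inside a supernode can become negative. Lower
    bound and expanded cost share the value [L], which gives optimality at the end. *)
Record inv (S0 S : config) (H : seq event) (L : R) : Prop := Inv {
  inv_wf : wf S;
  inv_red : forall a, is_arc a -> active S a -> (0 <= red S a)%R;
  inv_count : forall F, partial_sol S0 F -> forall u, u < n ->
    nonrep S (cls S u) < count (fun a => cls S a.2 == cls S u) F;
  inv_lower : forall F, partial_sol S0 F ->
    (L + \sum_(a <- F | active S a) red S a <= cost F)%R;
  inv_expand : forall F, partial_sol S F ->
    partial_sol S0 (expand H F) /\
    cost (expand H F) = (L + \sum_(a <- F) red S a)%R }.

(** [Some K] excepts the class that has just selected, whose arc may close a cycle; [None] makes no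
    exception. *)
Definition acyclic_but (S : config) (K : option nat) : Prop :=
  exists2 r, rep_compat S r &
    forall u, u < n -> sel S (cls S u) -> Some (cls S u) != K ->
      r (selx S (cls S u)) < r (selT S (cls S u)).

Definition init_config (S0 : config) : Prop :=
  [/\ forall u, u <= n -> rep S0 u = u & forall k, ~~ sel S0 k].

Lemma inv_init S0 : init_config S0 ->
  (forall u, u < n -> off S0 u = 0%R) -> (forall a, is_arc a -> 0 <= W a.1 a.2)%R ->
  inv S0 S0 [::] 0%R.
Proof.
move=> [repE selE] off0 W0.
have redE a : is_arc a -> red S0 a = W a.1 a.2.
  by case/andP=> _ h; rewrite /red off0 ?subr0.
split.
- split; first exact: repE.
  + by move=> u h; rewrite repE // ltnW.
  + by move=> u h; rewrite !repE // ltnW.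
  + by move=> u h; rewrite repE // ltnW.
  + by move=> u h; rewrite (negbTE (selE _)).
- by move=> a h _; rewrite redE ?W0.
- move=> F [r [_ _ _ hc]] u h; rewrite /nonrep (@eq_in_count _ _ pred0) ?count_pred0.
    have := hc u h; rewrite (negbTE (selE _)) -has_count => /mapP[a aF e].
    by apply/hasP; exists a; rewrite // e.
  by move=> v; rewrite mem_iota add0n => /andP[_ hv] /=; rewrite repE ?eqxx ?andbF // ltnW.
- move=> F [r [_ hF _ _]]; rewrite add0r big_mkcond /cost !big_seq.
  apply: ler_sum => a aF; have [ha _] := hF a aF.
  by case: ifP => _; rewrite ?redE ?W0.
- move=> F hF; split=> //=; rewrite add0r /cost !big_seq.
  by have [r [_ hr _ _]] := hF; apply: eq_bigr => a /hr[ha _]; rewrite redE.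
Qed.

(* In each supernode, a node of minimal rank is not entered from inside. *)
Lemma exists_active S F r u : wf S ->
  (forall a, a \in F -> is_arc a /\ r a.1 < r a.2) -> uniq [seq a.2 | a <- F] ->
  u < n -> nonrep S (cls S u) < count (fun a => cls S a.2 == cls S u) F ->
  exists2 a, a \in F & (cls S a.2 == cls S u) && active S a.
Proof.
move=> wS rF uF un lt; apply/hasP; apply: contraLR lt => /hasPn noact.
rewrite -leqNgt; set k := cls S u in noact *.
pose mn (t : nat) : nat :=
  if insub t is Some i then [arg min_(v < (i : 'I_n) | rep S v == t :> nat) r v] else 0.
have mnP t : t < n -> rep S t = t ->
    [/\ mn t < n, rep S (mn t) = t & forall v, v < n -> rep S v = t -> r (mn t) <= r v].
  move=> tn rt; rewrite /mn insubT; case: arg_minnP => /=; first by rewrite rt.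
  by move=> i /eqP ri mi; split=> // v vn /eqP rv; apply: (mi (Ordinal vn)).
pose A := [seq v <- iota 0 n | cls S v == k].
pose reps := [seq v <- A | rep S v == v].
pose heads := [seq a.2 | a <- F & cls S a.2 == k].
have sA : size A = nonrep S k + size reps.
  rewrite -(count_predC (fun v => rep S v != v) A) /nonrep /reps size_filter.
  by rewrite !count_filter; congr (_ + _); apply: eq_count => v /=; rewrite ?negbK andbC.
have inA v : (v \in A) = (cls S v == k) && (v < n) by rewrite mem_filter mem_iota add0n.
have repsP t : t \in reps -> [/\ t < n, rep S t = t & cls S t = k].
  by rewrite mem_filter inA => /and3P[/eqP-> /eqP-> ->].
(* Heads of arcs into the class and rank minima of its supernodes are disjoint nodes of the class,
   so comparing sizes bounds the number of heads by [nonrep S k]. *)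
suff: size (heads ++ map mn reps) <= size A.
  rewrite size_cat sA /heads !size_map size_filter; set x := count _ F; lia.
apply: uniq_leq_size.
  rewrite cat_uniq; apply/and3P; split.
  - by apply: subseq_uniq uF; apply: map_subseq; apply: filter_subseq.
  - apply/hasPn => _ /mapP[t /repsP[tn rt ct] ->]; apply/negP => /mapP[a].
    rewrite mem_filter => /andP[ca aF] me; have [[m1 m2 m3] [/andP[a1 a2] ra]] := (mnP t tn rt, rF a aF).
    have := noact a aF; rewrite ca /= /active negbK => /eqP re.
    have a1n : a.1 < n.
      rewrite ltn_neqAle a1 andbT; apply/eqP => e.
      by have := rep_lt wS a2; rewrite -re e (rep_n wS) ltnn.
    by have := m3 a.1 a1n; rewrite re me in m2 * => /(_ m2); rewrite -me leqNgt me ra.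
  - rewrite map_inj_in_uniq ?filter_uniq ?iota_uniq // => s t /repsP[s1 s2 _] /repsP[t1 t2 _] e.
    have [_ <- _] := mnP s s1 s2; have [_ <- _] := mnP t t1 t2; by rewrite e.
move=> v; rewrite mem_cat inA => /orP[/mapP[a]|/mapP[t /repsP[tn rt ct]] ->].
  by rewrite mem_filter => /andP[/eqP ca /rF[/andP[_ a2] _]] ->; rewrite ca eqxx a2.
have [m1 m2 _] := mnP t tn rt; by rewrite m1 -(cls_rep wS) // m2 ct eqxx.
Qed.

Lemma uniq_heads S F : uniq (hcls S F) -> uniq [seq a.2 | a <- F].
Proof. by rewrite /hcls (map_comp (cls S) snd); apply: map_uniq. Qed.

Record event_spec (S S' : config) (x v : nat) (K : nat) (Kp : pred nat) : Prop := EventSpec {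
  ev_rep : forall u, u <= n -> rep S' u = rep S u;
  ev_cls : forall u, u < n -> cls S' u = cls S u;
  ev_sel : forall u, u < n -> sel S' (cls S u) = sel S (cls S u) || (cls S u == K);
  ev_selx : forall u, u < n -> cls S u != K -> selx S' (cls S u) = selx S (cls S u);
  ev_selT : forall u, u < n -> cls S u != K -> selT S' (cls S u) = selT S (cls S u);
  ev_x : selx S' K = x;
  ev_T : selT S' K = rep S v;
  ev_off : forall u, u < n ->
    off S' u = (if cls S u == K then off S u + red S (x, v) else off S u)%R;
  ev_mem : forall u, u < n -> Kp u = (cls S u == K) }.

(** By [exists_active], every solution has an active arc into [K], and this arc pays for raising the
    lower bound by [lam]. In the expansion, the set handed to the older events has exactly one arc
    into [K], either already in [F] or the new [(x, v)], and it accounts for the same [lam]. *)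
Lemma event_step S0 S S' H L x v Kp :
  inv S0 S H L -> acyclic_but S None ->
  is_arc (x, v) -> active S (x, v) -> ~~ sel S (cls S v) ->
  (forall a, is_arc a -> active S a -> cls S a.2 = cls S v -> red S (x, v) <= red S a)%R ->
  event_spec S S' x v (cls S v) Kp ->
  inv S0 S' ((Kp, (x, v)) :: H) (L + red S (x, v))%R /\ acyclic_but S' (Some (cls S v)).
Proof.
move=> I [ra compat_ra ra_lt] axv act nsel mini E; have wS := inv_wf I.
set K := cls S v in E nsel mini *; set lam := red S (x, v).
have /andP[/= xn vn] := axv.
have [E1 E2 E3 E4 E5 E6 E7 E8 E9] := E.
have actE a : is_arc a -> active S' a = active S a.
  by case/andP=> a1 a2; rewrite /active !E1 // ltnW.
have redE a : is_arc a -> red S' a = (red S a - (if cls S a.2 == K then lam else 0))%R.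
  by case/andP=> a1 a2; rewrite /red E8 //; case: ifP => _; rewrite -/lam; lra.
have hclsE F : (forall a, a \in F -> is_arc a) -> hcls S' F = hcls S F.
  by move=> hF; apply/eq_in_map => a /hF/andP[_]; apply: E2.
have lam0 : (0 <= lam)%R by apply: (inv_red I).
have rv : rep S v < n by apply: (rep_lt wS).
split; last first.
  exists ra.
    by move=> u u' un un'; rewrite !E1 //; apply: compat_ra.
  move=> u un; rewrite E2 // E3 // -/K => h1 h2.
  have {h2} neK : cls S u != K by apply: contra h2 => /eqP->.
  by move: h1; rewrite (negbTE neK) orbF E4 // E5 // => h1; apply: ra_lt.
split.
- split.
  + by rewrite E1 ?rep_n.
  + by move=> u un; rewrite E1 ?rep_lt // ltnW.
  + by move=> u un; rewrite !E1 ?rep_idem ?(ltnW (rep_lt _ _)) // ltnW.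
  + by move=> u un; rewrite E1 ?(ltnW un) // !E2 ?cls_rep ?rep_lt.
  + move=> u un; rewrite E2 // E3 //; have [->|neK] := eqVneq (cls S u) K.
      by rewrite E6 E7 E2 // E1 ?(ltnW rv) // rep_idem ?cls_rep.
    rewrite orbF E4 // E5 // => /(sel_wf wS un)[h1 h2 h3 h4].
    by rewrite E2 // E1 ?(ltnW h2).
- move=> a aa; rewrite actE // redE // => act'.
  by have := inv_red I aa act'; case: eqP => [/(mini _ aa act')|_]; rewrite -/lam; lra.
- move=> F hF u un; rewrite E2 //; have := inv_count I hF un.
  have [r [_ hr _ _]] := hF.
  rewrite /nonrep; congr (_ < _); last first.
    by apply: eq_in_count => a /hr[/andP[_ a2] _] /=; rewrite E2.
  apply: eq_in_count => w; rewrite mem_iota add0n => /andP[_ wn] /=.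
  by rewrite E2 // E1 // ltnW.
- move=> F hF; have [r [_ hr hu _]] := hF.
  have lower := inv_lower I hF; apply: le_trans lower.
  have hasK : (lam <= \sum_(a <- F | active S a) (if cls S a.2 == K then lam else 0))%R.
    have [a aF /andP[ca acta]] := exists_active wS hr (uniq_heads hu) vn (inv_count I hF vn).
    rewrite (big_rem a) //= acta ca lerDl; apply: sumr_ge0 => i _.
    by case: ifP.
  rewrite -addrA lerD2l -lerBrDl.
  have -> : (\sum_(a <- F | active S' a) red S' a =
     \sum_(a <- F | active S a) red S a -
     \sum_(a <- F | active S a) (if cls S a.2 == K then lam else 0))%R.
    rewrite -sumrB big_seq_cond [RHS]big_seq_cond.
    apply: eq_big => [a|a /andP[/hr[aa _] _]]; last by rewrite redE.
    by case: (boolP (a \in F)) => //= /hr[aa _]; rewrite actE.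
  rewrite -/lam; lra.
- move=> F [r [cr hr hu hs]] /=.
  have hFarc a : a \in F -> is_arc a by move=> /hr[].
  have rT u : u <= n -> r (rep S u) = r u.
    rewrite leq_eqVlt => /orP[/eqP->|un]; first by rewrite (rep_n wS).
    by apply: cr; rewrite ?(ltnW un) ?(ltnW (rep_lt wS un)) // !E1 ?rep_idem ?(ltnW (rep_lt wS un)) // ltnW.
  have hasE : has (fun a => Kp a.2) F = (K \in hcls S F).
    apply/hasP/mapP => [[a aF e]|[a aF e]]; exists a => //.
      by move: e; rewrite E9; [move/eqP | have /andP[] := hFarc a aF].
    by rewrite E9 ?e //; have /andP[] := hFarc a aF.
  rewrite hclsE // in hu.
  have sumE : (\sum_(a <- F) red S' a = \sum_(a <- F) red S a - (K \in hcls S F)%:R * lam)%R.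
    rewrite (eq_big_seq (fun a => red S a - (if cls S a.2 == K then lam else 0))%R); last first.
      by move=> a /hFarc; apply: redE.
    rewrite sumrB; congr (_ - _)%R; rewrite -big_mkcond /= -(big_map (fun a => cls S a.2) (pred1 K) (fun=> lam)).
    rewrite -big_filter; have [hK|hK] := boolP (K \in _).
      by rewrite (filter_pred1_uniq hu hK) big_seq1 mul1r.
    rewrite (_ : [seq _ <- _ | _] = [::]) ?big_nil ?mul0r //.
    by apply/eqP; rewrite -[_ == _]negbK -has_filter has_pred1.
  rewrite hasE sumE.
  have cr' : rep_compat S r by move=> u u' un un' e; apply: cr; rewrite // !E1.
  case: (boolP (K \in hcls S F)) => hK.
    have [|h1 ->] := inv_expand I (F := F).
      exists r; split=> // u un; have := hs u un; rewrite !E2 // hclsE // E3 //.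
      have [->|neK] := eqVneq (cls S u) K; first by rewrite (negbTE nsel).
      by rewrite orbF E4 // E5.
    by split=> //; rewrite mul1r -/lam; lra.
  have [|h1 ->] := inv_expand I (F := (x, v) :: F); last first.
    by split=> //; rewrite mul0r big_cons -/lam; lra.
  exists r; split=> //.
  (* The rank condition imposed on the kept selection of [K] is the one needed for [(x, v)], because
     the rank is constant on the supernode of [v]. *)
  - move=> a; rewrite inE => /predU1P[->|/hr //]; split=> //=.
    have := hs v vn; rewrite E2 // E3 // -/K eqxx orbT hclsE // => /(_ hK).
    by rewrite E6 E7 rT // ltnW.
  - by rewrite /= hK.
  - move=> u un; have := hs u un; rewrite !E2 // hclsE // E3 // /hcls /= !inE -/K.
    have [->|neK] := eqVneq (cls S u) K; first by rewrite (negbTE nsel).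
    by rewrite orbF E4 // E5.
Qed.

(** * Merging a cycle of supernodes *)

Definition par (S : config) (z : nat) : nat := rep S (selx S (cls S z)).

(** The list follows the selected arcs backwards. The condition on [selT] is needed because the
    class of [z] may own further supernodes, and its arc has to enter [z] itself. *)
Record cycle_ok (S : config) (T : nat) (c : seq nat) : Prop := CycleOk {
  cyc_uniq : uniq c;
  cyc_cycle : fcycle (par S) c;
  cyc_T : T \in c;
  cyc_node : forall z, z \in c ->
    [/\ z < n, rep S z = z, sel S (cls S z) & selT S (cls S z) = z] }.

Record merge_spec (S S' : config) (T : nat) (c : seq nat) : Prop := MergeSpec {
  mg_rep : forall u, u <= n -> rep S' u = if rep S u \in c then T else rep S u;
  mg_cls : forall u, u < n ->
    cls S' u = if cls S u \in map (cls S) c then cls S T else cls S u;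
  mg_sel : forall u, u < n -> sel S' (cls S u) = sel S (cls S u) && (cls S u != cls S T);
  mg_selx : forall u, u < n -> selx S' (cls S u) = selx S (cls S u);
  mg_selT : forall u, u < n -> selT S' (cls S u) = selT S (cls S u);
  mg_off : forall u, u < n -> off S' u = off S u }.

Lemma count_sum_classes (A : eqType) (f : A -> nat) (P : pred A) (s : seq nat) (l : seq A) :
  uniq s -> count (fun x => (f x \in s) && P x) l =
            \sum_(k <- s) count (fun x => (f x == k) && P x) l.
Proof.
elim: s => [_|k s IH /= /andP[ks us]].
  by rewrite big_nil; apply/eqP; rewrite -leqn0 leqNgt -has_count -all_predC; apply/allP.
rewrite big_cons -IH // -count_predUI [X in _ + X](_ : _ = 0) ?addn0.
  by apply: eq_count => x /=; rewrite inE andb_orl.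
apply/eqP; rewrite -leqn0 leqNgt -has_count; apply/hasPn => x _ /=.
by apply/negP => /and3P[/andP[/eqP-> _] h _]; rewrite h in ks.
Qed.

Lemma leq_in_count (A : eqType) (p q : pred A) (s : seq A) :
  (forall x, x \in s -> p x -> q x) -> count p s <= count q s.
Proof.
move=> pq; rewrite (@eq_in_count _ p (predI p q)) => [|x /pq xs /=].
  by apply: sub_count => x /andP[].
by case: (p x) xs => //= ->.
Qed.

Section MergeStep.
Variables (S S' : config) (T : nat) (c : seq nat).
Hypotheses (wS : wf S) (C : cycle_ok S T c) (M : merge_spec S S' T c).

Let K := cls S T.
Let mc := map (cls S) c.

(** A class selects a single arc, which enters a single supernode, so distinct supernodes of the
    cycle belong to distinct classes. *)
Lemma mc_uniq : uniq mc.
Proof.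
rewrite map_inj_in_uniq ?(cyc_uniq C) // => z z' /(cyc_node C)[_ _ _ e1].
by move=> /(cyc_node C)[_ _ _ e2] e; rewrite -e1 -e2 e.
Qed.

Lemma K_mc : K \in mc. Proof. by apply/map_f/(cyc_T C). Qed.

Lemma rep_cyc u : u < n -> rep S u \in c -> cls S u \in mc.
Proof. by move=> un h; rewrite -(cls_rep wS un); apply: map_f. Qed.

Lemma cyc_n : n \notin c.
Proof. by apply/negP => /(cyc_node C)[]; rewrite ltnn. Qed.

Lemma sel_mc u : u < n -> cls S u \in mc -> sel S (cls S u).
Proof. by move=> _ /mapP[z /(cyc_node C)[_ _ h _] ->]. Qed.

Lemma merged_sel u : u < n -> sel S' (cls S' u) ->
  [/\ cls S u \notin mc, cls S' u = cls S u, cls S u != K & sel S (cls S u)].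
Proof.
move=> un; rewrite (mg_cls M un) -/mc; case: ifP => h.
  by have [Tn _ _ _] := cyc_node C (cyc_T C); rewrite (mg_sel M) // eqxx andbF.
by rewrite (mg_sel M) // => /andP[-> ->].
Qed.

Lemma merge_selT u : u < n -> cls S u \notin mc -> sel S (cls S u) ->
  selT S (cls S u) \notin c.
Proof.
move=> un h /(sel_wf wS un)[_ _ h1 _]; apply: contra h => h.
by rewrite -h1; apply: map_f.
Qed.

Lemma wf_merge : wf S'.
Proof.
have [Tn rT sT eT] := cyc_node C (cyc_T C).
split.
- by rewrite (mg_rep M) // rep_n // (negbTE cyc_n).
- by move=> u un; rewrite (mg_rep M) ?(ltnW un) //; case: ifP => _; rewrite ?rep_lt.
- move=> u un; rewrite (mg_rep M (ltnW un)); case: ifP => h.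
    by rewrite (mg_rep M) ?(ltnW Tn) // rT (cyc_T C).
  by rewrite (mg_rep M) ?(ltnW (rep_lt _ _)) // rep_idem // h.
- move=> u un; rewrite (mg_rep M (ltnW un)); case: ifP => h.
    by rewrite !(mg_cls M) // -/mc K_mc rep_cyc.
  by rewrite !(mg_cls M) ?rep_lt // cls_rep.
- move=> u un /merged_sel[//|h1 -> h2 h3].
  have [h4 h5 h6 h7] := sel_wf wS un h3.
  rewrite (mg_selx M) // (mg_selT M) // (mg_cls M) // h6 -/mc (negbTE h1).
  by rewrite (mg_rep M (ltnW h5)) h7 (negbTE (merge_selT un h1 h3)).
Qed.

(** The merged class is unselected, so no arc has to enter the new supernode: it can take rank 0,
    below all other ranks shifted by one. *)
Lemma merge_acyclic : acyclic_but S (Some K) -> acyclic_but S' None.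
Proof.
move=> [r cr hr]; exists (fun u => if rep S' u == T then 0 else (r u).+1).
  move=> u v un vn e; rewrite -e; case: eqP => // h; congr _.+1; apply: cr => //.
  move: e h; rewrite !(mg_rep M) //; case: ifP => // _; case: ifP => // _ -> //.
move=> u un /(merged_sel un)[h1 -> h2 h3] _.
have [h4 h5 h6 h7] := sel_wf wS un h3.
rewrite (mg_selx M) // (mg_selT M) // (mg_rep M (ltnW h5)) h7.
have h8 := merge_selT un h1 h3; rewrite (negbTE h8).
have -> : selT S (cls S u) == T = false.
  by apply: contraNF h8 => /eqP->; apply: (cyc_T C).
by case: ifP => // _; rewrite ltnS; apply: hr.
Qed.

(** For a cycle of [d] supernodes, the strict inequalities of its [d] classes add up with a surplus
    of [d], while only the [d - 1] supernodes other than [T] cease to be representatives. *)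
Lemma merge_count (F : seq arc) u :
  (forall a, a \in F -> is_arc a) ->
  (forall u, u < n -> nonrep S (cls S u) < count (fun a => cls S a.2 == cls S u) F) ->
  u < n -> nonrep S' (cls S' u) < count (fun a => cls S' a.2 == cls S' u) F.
Proof.
move=> hF hS un.
have inj v : v < n -> cls S u \notin mc -> (cls S' v == cls S u) = (cls S v == cls S u).
  move=> vn h; rewrite (mg_cls M vn) -/mc; case: ifP => // h1.
  by apply/eqP/eqP => e; move: h; rewrite -e ?K_mc ?h1.
rewrite (mg_cls M un) -/mc; case: ifPn => h; last first.
  have := hS u un; congr (_ < _).
    apply: eq_in_count => v; rewrite mem_iota add0n => /andP[_ vn] /=.
    rewrite inj //; case: eqP => //= e; rewrite (mg_rep M (ltnW vn)); case: ifP => //.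
    by move=> /(rep_cyc vn); rewrite e (negbTE h).
  by apply: eq_in_count => a /hF/andP[_ an] /=; rewrite inj.
have toK v : v < n -> (cls S' v == cls S T) = (cls S v \in mc).
  move=> vn; rewrite (mg_cls M vn) -/mc; case: ifP => hv; first by rewrite eqxx.
  by apply/negbTE; apply: contraFN hv => /eqP->; apply: K_mc.
have Tn := cyc_node C (cyc_T C).
have sumF : count (fun a => cls S' a.2 == cls S T) F =
    \sum_(k <- mc) count (fun a => cls S a.2 == k) F.
  rewrite (eq_in_count (a2 := fun a => (cls S a.2 \in mc) && true)).
    rewrite (count_sum_classes (fun a => cls S a.2) predT) ?mc_uniq //.
    by apply: eq_bigr => k _; apply: eq_count => a /=; rewrite andbT.
  by move=> a /hF/andP[_ an] /=; rewrite toK // andbT.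
have sumN : nonrep S' (cls S T) <= \sum_(k <- mc) nonrep S k + (size c).-1.
  rewrite -(count_sum_classes _ _ _ mc_uniq) -(size_rem (cyc_T C)).
  set s := iota 0 n.
  have -> : size (rem T c) = count (mem (rem T c)) s + (size (rem T c) - count (mem (rem T c)) s).
    rewrite subnKC // -size_filter; apply: uniq_leq_size; first by rewrite filter_uniq ?iota_uniq.
    by move=> v; rewrite mem_filter => /andP[].
  rewrite addnA; apply: leq_trans (leq_addr _ _); rewrite -count_predUI.
  apply: leq_trans (leq_addr _ _).
  apply: leq_in_count => v; rewrite mem_iota add0n => /andP[_ vn] /=.
  rewrite toK // => /andP[-> /=]; rewrite (mg_rep M (ltnW vn)) (rem_filter _ (cyc_uniq C)).
  rewrite mem_filter /=; case: ifP => hr; case: (eqVneq (rep S v) v) => //= e.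
  by rewrite e in hr; rewrite hr eq_sym => ->.
rewrite sumF; apply: leq_ltn_trans sumN _.
have sc : size c = size mc by rewrite size_map.
have pos : 0 < size c by case: (c) (cyc_T C).
suff : \sum_(k <- mc) nonrep S k + size c <= \sum_(k <- mc) count (fun a => cls S a.2 == k) F.
  by move: pos; case: (size c) => // m; rewrite addnS.
rewrite sc -sum1_size -big_split /= !big_seq; apply: leq_sum => _ /mapP[z zc ->].
by rewrite addn1; apply: hS; have [] := cyc_node C zc.
Qed.

(* The cycle is opened at the supernode [z0] whose class has an arc in [F]; the
   rank is refined by the position on the cycle, counted from [z0]. *)
Lemma merge_expand F : partial_sol S' F -> partial_sol S F.
Proof.
have [Tn rT sT eT] := cyc_node C (cyc_T C).
move=> [r' [cr' hr' hu' hs']].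
have hclsE : hcls S' F = [seq if k \in mc then K else k | k <- hcls S F].
  rewrite /hcls -map_comp; apply/eq_in_map => a /hr'[/andP[_ an] _] /=.
  by rewrite (mg_cls M an).
have mem_hcls k : k \notin mc -> (k \in hcls S' F) = (k \in hcls S F).
  move=> kmc; rewrite hclsE; apply/mapP/idP => [[k' k'F]|kF]; last by exists k; rewrite ?(negbTE kmc).
  by case: ifP => [_ e|_ ->//]; rewrite e K_mc in kmc.
(* The merged class is unselected, so an arc of [F] enters it; before the merge that arc entered the
   class of some supernode of the cycle. *)
have [z0 z0c z0F] : exists2 z0, z0 \in c & cls S z0 \in hcls S F.
  have := hs' T Tn; rewrite (mg_cls M Tn) -/mc K_mc (mg_sel M Tn) eqxx andbF hclsE.
  move=> /mapP[k kF]; case: ifP => [/mapP[z zc e] _|nk e]; last by rewrite -e K_mc in nk.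
  by exists z; rewrite -?e.
have [i c' rotE] := rot_to z0c.
(* With [z0] at the end, every other step of [par] raises the index by one. The step from [z0] would
   close the cycle, but its selected arc is not kept. *)
pose d := rcons c' z0.
have ud : uniq d by rewrite rcons_uniq -cons_uniq -rotE rot_uniq (cyc_uniq C).
have memd z : (z \in d) = (z \in c) by rewrite mem_rcons -rotE mem_rot.
have next_d z : z \in c -> z != z0 ->
    par S z \in c /\ index (par S z) d = (index z d).+1.
  rewrite -!memd {1}mem_rcons inE => zd nz; rewrite (negbTE nz) /= in zd.
  have : fcycle (par S) (z0 :: c') by rewrite -rotE rot_cycle (cyc_cycle C).
  have lt : index z d < size c' by rewrite /d -cats1 index_cat zd index_mem.
  move=> /= /(pathP 0) /(_ (index z d).+1); rewrite size_rcons ltnS lt => /(_ isT) /=.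
  rewrite -/d nth_index ?mem_rcons ?inE ?zd ?orbT // => /eqP ->.
  have ltd : (index z d).+1 < size d by rewrite size_rcons ltnS.
  by rewrite index_uniq // -in_cons -mem_rcons mem_nth.
pose N := (size d).+1.
(* A lexicographic rank: [N] exceeds the second summand, which falls with the index because [par]
   goes against the arcs. Off the cycle the index is [size d] and the summand 0. *)
exists (fun u => r' u * N + (size d - index (rep S u) d)).
have lex u v : r' u < r' v ->
    r' u * N + (size d - index (rep S u) d) < r' v * N + (size d - index (rep S v) d).
  move=> lt; apply: leq_trans (leq_addr _ _).
  apply: (@leq_trans ((r' u).+1 * N)); last by rewrite leq_mul2r lt orbT.
  by rewrite mulSn addnC ltn_add2r ltnS leq_subr.
split.
- move=> u v un vn e; rewrite e; congr (_ * _ + _); apply: cr' => //.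
  by rewrite !(mg_rep M) // e.
- by move=> a /hr'[h1 h2]; split=> //; apply: lex.
- by move: hu'; rewrite hclsE; apply: map_uniq.
- move=> u un; have hsu := hs' u un; have [|] := boolP (cls S u \in mc) => umc.
    rewrite (sel_mc un umc) => nF; case/mapP: umc => z zc e.
    have [zn rz sz Tz] := cyc_node C zc; rewrite e in nF *; rewrite Tz.
    have nz : z != z0 by apply: contraNneq nF => ->.
    have [xn _ _ _] := sel_wf wS zn sz.
    have [pc indE] := next_d z zc nz.
    have -> : r' (selx S (cls S z)) = r' z.
      apply: cr' => //; first exact: ltnW.
      by rewrite !(mg_rep M) ?(ltnW zn) // rz zc -/(par S z) pc.
    rewrite -/(par S z) rz ltn_add2l indE; have : index z d < size d by rewrite index_mem memd.
    lia.
  move: hsu; rewrite (mg_cls M un) -/mc (negbTE umc) (mg_sel M un) (mg_selx M un) (mg_selT M un).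
  have -> : cls S u != cls S T by apply: contraNneq umc => ->; apply: K_mc.
  by rewrite andbT mem_hcls //; case: ifP => // _ h /h; apply: lex.
Qed.

End MergeStep.

(** Merging leaves reduced weights unchanged and only takes arcs out of the active ones; these had
    nonnegative reduced weight, so the lower bound survives with the same [L]. *)
Lemma merge_step S0 S S' H L T c :
  inv S0 S H L -> acyclic_but S (Some (cls S T)) -> cycle_ok S T c -> merge_spec S S' T c ->
  inv S0 S' H L /\ acyclic_but S' None.
Proof.
move=> I ac C M; have wS := inv_wf I; split; last exact: (merge_acyclic wS C M ac).
have actS a : is_arc a -> active S' a -> active S a.
  case/andP=> a1 a2; rewrite /active !(mg_rep M) // ?(ltnW a2) //.
  by apply: contraNneq => ->.
have redE a : is_arc a -> red S' a = red S a.
  by case/andP=> _ a2; rewrite /red (mg_off M).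
split.
- exact: (wf_merge wS C M).
- by move=> a aa act; rewrite redE //; apply: (inv_red I) => //; apply: actS.
- move=> F hF u un; have [r [_ hr _ _]] := hF.
  by apply: (merge_count wS C M) => // [a /hr[]//|v vn]; apply: (inv_count I).
- move=> F hF; have [r [_ hr _ _]] := hF.
  apply: le_trans (inv_lower I hF); rewrite lerD2l big_mkcond [leRHS]big_mkcond /=.
  rewrite !big_seq; apply: ler_sum => a /hr[aa _]; rewrite redE //.
  case: ifP => [/(actS a aa)->//|_]; by case: ifP => // h; apply: (inv_red I).
- move=> F hF; have [r [_ hr _ _]] := hF.
  have [h1 ->] := inv_expand I (merge_expand wS C M hF); split=> //.
  by congr (_ + _)%R; apply: eq_big_seq => a /hr[aa _]; rewrite redE.
Qed.

(** * Tracing selected arcs backwards from a new selection *)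

Section Walk.
Variables (S : config) (T : nat).
Let K := cls S T.

(** The last test is for classes with several supernodes: only the one entered by the selected arc
    has a predecessor. *)
Definition guard (z : nat) : bool :=
  [&& z != n, z != T, sel S (cls S z) & selT S (cls S z) == z].

(** Idling at the end of the walk lets a loop of exactly [n] rounds carry it out. *)
Definition wstep (z : nat) : nat := if guard z then par S z else z.

Fixpoint walk (z : nat) (q : seq nat) (e : nat) : bool :=
  if q is y :: q' then [&& y == z, guard z & walk (par S z) q' e]
  else (z == e) && ~~ guard z.

Lemma walk_det z q q' e e' : walk z q e -> walk z q' e' -> e = e'.
Proof.
elim: q q' z => [|y q IH] [|y' q'] z //=.
- by move=> /andP[/eqP-> _] /andP[/eqP-> _].
- by move=> /andP[_ /negbTE->] /and3P[].
- by move=> /and3P[_ h _] /andP[_]; rewrite h.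
- by move=> /and3P[_ _ h] /and3P[_ _]; apply: IH.
Qed.

Lemma walk_iter z q e k : walk z q e -> size q <= k -> iter k wstep z = e.
Proof.
elim: q z k => [|y q IH] z k /=.
  move=> /andP[/eqP-> h] _; elim: k => //= k ->; by rewrite /wstep (negbTE h).
move=> /and3P[_ h hw]; case: k => // k /(IH _ _ hw) <-.
by rewrite iterSr /wstep h.
Qed.

Lemma walk_path z y q : walk z (y :: q) T -> path (frel (par S)) z (rcons q T).
Proof.
elim: q z y => [|y' q IH] z y; first by move=> /and3P[_ _ /andP[/eqP <- _]] /=; rewrite eqxx.
move=> /and3P[_ gz hw]; have /andP[/eqP e _] := hw; rewrite rcons_cons.
by apply/andP; split; [rewrite /= e | rewrite e; apply: IH hw].
Qed.

Hypotheses (wS : wf S) (Tn : T < n) (rT : rep S T = T).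
Hypotheses (sT : sel S K) (sTE : selT S K = T) (aS : acyclic_but S (Some K)).

Lemma guard_node z : z <= n -> rep S z = z -> guard z ->
  [/\ z < n, par S z <= n, rep S (par S z) = par S z & cls S z != K].
Proof.
move=> zn rz /and4P[nz nT sz /eqP Tz]; have {nz}zn : z < n by rewrite ltn_neqAle nz.
have [xn _ _ _] := sel_wf wS zn sz; rewrite /par; split=> //.
- by move: xn; rewrite leq_eqVlt => /predU1P[->|/(rep_lt wS)/ltnW//]; rewrite rep_n.
- by move: xn; rewrite leq_eqVlt => /predU1P[->|/(rep_idem wS)//]; rewrite !rep_n.
- by apply: contraNneq nT => e; rewrite -Tz e sTE.
Qed.

(** A guarded supernode is never of class [K], whose arc enters [T], so the rank from [aS] falls
    strictly along the walk. The visited nodes are thus distinct, which bounds their number by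
    [n]. *)
Lemma walk_total z : z <= n -> rep S z = z ->
  exists q e, [/\ walk z q e, size q <= n, uniq q, e <= n & rep S e = e /\
    forall y, y \in q -> [/\ y < n, rep S y = y & guard y]].
Proof.
have [r cr hr] := aS.
have par_lt y : y <= n -> rep S y = y -> guard y -> r (par S y) < r y.
  move=> yn ry gy; have [yn' pn rp nK] := guard_node yn ry gy.
  have /and4P[_ _ sy /eqP Ty] := gy; have [xn _ _ _] := sel_wf wS yn' sy.
  rewrite -[X in _ < r X]Ty (cr (par S y) (selx S (cls S y))) //; exact: hr.
suff: z <= n -> rep S z = z -> exists q e, [/\ walk z q e, uniq q, e <= n & rep S e = e /\
    forall y, y \in q -> [/\ y < n, rep S y = y & guard y /\ r y <= r z]].
  move=> h zn rz; have [q [e [h1 h2 h3 [h4 h5]]]] := h zn rz; exists q, e; split=> //.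
    rewrite -[n](size_iota 0); apply: uniq_leq_size => // y /h5[yn _ _].
    by rewrite mem_iota add0n.
  by split=> // y /h5[? ? []].
have [m] := ubnP (r z); elim: m z => // m IH z; rewrite ltnS => rm zn rz.
have [gz|gz] := boolP (guard z); last by exists [::], z; rewrite /= eqxx.
have [zn' pn rp _] := guard_node zn rz gz; have lt := par_lt z zn rz gz.
have [q [e [h1 h2 h3 [h4 h5]]]] := IH (par S z) (leq_trans lt rm) pn rp.
exists (z :: q), e; split=> //=; first by rewrite eqxx gz.
  rewrite h2 andbT; apply/negP => /h5[_ _ [_]]; by rewrite leqNgt lt.
split=> // y; rewrite inE => /predU1P[->|/h5[? ? [? h]]]; first by split.
by split=> //; split=> //; apply: leq_trans h (ltnW lt).
Qed.

Hypothesis Tpar : par S T != T.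

(** If the walk from the tail of the new arc misses [T], all nodes whose walk reaches [T] are raised
    by [N], above every old rank. The new arc then goes up, and the others still do, since the walk
    from a head reaches [T] whenever the one from its tail does. *)
Lemma walk_cases : let e := iter n wstep (par S T) in
  if e == T then
    exists q, [/\ walk (par S T) q T, q != [::], cycle_ok S T (T :: q) & size q <= n]
  else acyclic_but S None.
Proof.
move=> e; have [xn _ _ _] := sel_wf wS Tn sT; rewrite -/K in xn.
have pn : par S T <= n.
  by move: xn; rewrite /par leq_eqVlt => /predU1P[->|/(rep_lt wS)/ltnW//]; rewrite rep_n.
have rep_rep u : u <= n -> rep S (rep S u) = rep S u.
  by rewrite leq_eqVlt => /predU1P[->|/(rep_idem wS)//]; rewrite !rep_n.
have rp : rep S (par S T) = par S T by rewrite rep_rep.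
have [q [e' [h1 h2 h3 h4 [h5 h6]]]] := walk_total pn rp.
have eE : e = e' by apply: walk_iter h1 h2.
case: eqP => [eT|/eqP neT].
  rewrite -eE eT in h1; have nq : q != [::].
    by apply: contraNneq Tpar => q0; move: h1; rewrite q0 /= => /andP[].
  exists q; split=> //; split=> /=.
  - by rewrite h3 andbT; apply/negP => /h6[_ _ /and4P[_]]; rewrite eqxx.
  - case: q nq h1 {h2 h3 h6} => // y q _ h1; have := walk_path h1.
    by case/andP: h1 => /eqP-> _ /= ->; rewrite eqxx.
  - exact: mem_head.
  - move=> z; rewrite inE => /predU1P[->//|/h6[zn rz /and4P[_ _ sz /eqP Tz]]].
    by split.
have [r cr hr] := aS.
pose N := (\max_(u < n.+1) r u).+1.
have rN u : u <= n -> r u < N.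
  by rewrite -ltnS => un; rewrite ltnS (leq_bigmax (Ordinal un)).
pose D u := iter n wstep (rep S u) == T.
have repn u : u <= n -> rep S u <= n.
  by rewrite leq_eqVlt => /predU1P[->|/(rep_lt wS)/ltnW//]; rewrite rep_n.
exists (fun u => r u + (if D u then N else 0)).
  by move=> u v un vn e0; rewrite /D e0; congr (_ + _); apply: cr.
move=> u un su _; have [xun Tun cT rTu] := sel_wf wS un su.
have [eK|nK] := eqVneq (cls S u) K.
  have -> : D (selT S (cls S u)).
    rewrite eK sTE /D rT (@walk_iter _ [::] T) //=.
    by rewrite eqxx /guard eqxx andbF.
  by rewrite {1}/D eK (negbTE neT) addn0; apply: ltn_addl; apply: rN.
have lt : r (selx S (cls S u)) < r (selT S (cls S u)) by apply: hr => //; rewrite (inj_eq (@Some_inj _)).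
have gT : guard (selT S (cls S u)).
  rewrite /guard cT su eqxx !andbT neq_ltn Tun /=.
  by apply: contraNneq nK => e0; rewrite -cT e0.
case: ifP => [|_]; last by rewrite addn0 ltn_addr.
rewrite /D rTu => /eqP Dx.
have [q' [e0 [w1 w2 _ _ _]]] := walk_total (repn _ xun) (rep_rep _ xun).
have e0T : e0 = T by rewrite -Dx (walk_iter w1 w2).
have [q2 [e2 [v1 v2 _ _ _]]] := walk_total (ltnW Tun) rTu.
have w3 : walk (selT S (cls S u)) (selT S (cls S u) :: q') T.
  by rewrite /= eqxx gT /par cT -e0T.
by rewrite (walk_iter v1 v2) (walk_det v1 w3) eqxx ltn_add2r.
Qed.

End Walk.

(** Once every class has selected, the empty list is a partial solution, so its expansion costs
    exactly [L], which [inv_lower] makes a lower bound. *)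
Lemma optimal_expand S0 S H L : inv S0 S H L -> acyclic_but S None ->
  (forall u, u < n -> sel S (cls S u)) ->
  partial_sol S0 (expand H [::]) /\
  forall F, partial_sol S0 F -> (cost (expand H [::]) <= cost F)%R.
Proof.
move=> I [r cr hr] all_sel; have [|h1 h2] := inv_expand I (F := [::]).
  exists r; split=> // u un; rewrite all_sel // => _; apply: hr => //; exact: all_sel.
split=> // F hF; apply: le_trans (inv_lower I hF); rewrite h2 big_nil lerD2l.
rewrite big_seq_cond; apply: sumr_ge0 => a /andP[aF act]; apply: (inv_red I) => //.
by have [r' [_ /(_ a aF)[]]] := hF.
Qed.

(** * Data for the running time: the potential and the tables of best arcs *)

Definition supernodes (S : config) : nat := count (fun v => rep S v == v) (iota 0 n).
Definition unselected (S : config) : nat :=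
  size (undup [seq cls S u | u <- iota 0 n & ~~ sel S (cls S u)]).

Lemma mem_unselected S k :
  reflect (exists2 u, u < n & ~~ sel S (cls S u) /\ k = cls S u)
    (k \in undup [seq cls S u | u <- iota 0 n & ~~ sel S (cls S u)]).
Proof.
rewrite mem_undup; apply: (iffP mapP) => [[u]|[u un [su ->]]].
  by rewrite mem_filter mem_iota add0n => /andP[su /andP[_ un]] ->; exists u.
by exists u; rewrite // mem_filter su mem_iota add0n.
Qed.

Lemma potential_le S : supernodes S + unselected S <= 2 * n.
Proof.
rewrite mul2n -addnn leq_add //; first by rewrite -[X in _ <= X](size_iota 0); apply: count_size.
apply: leq_trans (size_undup _) _; rewrite size_map size_filter.
by rewrite -[X in _ <= X](size_iota 0); apply: count_size.
Qed.

Lemma event_potential S S' x v Kp : v < n -> ~~ sel S (cls S v) ->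
  event_spec S S' x v (cls S v) Kp ->
  supernodes S' = supernodes S /\ unselected S' < unselected S.
Proof.
move=> vn sv E; split.
  by apply: eq_in_count => u; rewrite mem_iota add0n => /andP[_ /ltnW un] /=; rewrite (ev_rep E).
set l := undup [seq cls S' u | u <- iota 0 n & ~~ sel S' (cls S' u)].
have inl k : k \in l -> exists2 u, u < n & [/\ ~~ sel S (cls S u), cls S u != cls S v & k = cls S u].
  move=> /mem_unselected[u un []]; rewrite (ev_cls E) // (ev_sel E) // negb_or.
  by move=> /andP[h1 h2] ->; exists u.
apply: (@uniq_leq_size _ (cls S v :: l)).
  rewrite /= undup_uniq andbT; apply/negP => /inl[u _ [_]] /[swap] ->.
  by rewrite eqxx.
move=> k; rewrite inE => /predU1P[->|/inl[u un [h1 _ ->]]]; apply/mem_unselected.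
  by exists v.
by exists u.
Qed.

Lemma merge_potential S S' T q : wf S -> cycle_ok S T (T :: q) -> merge_spec S S' T (T :: q) ->
  supernodes S' + size q <= supernodes S /\ unselected S' <= (unselected S).+1.
Proof.
move=> wS C M; have [Tn rT sT eT] := cyc_node C (cyc_T C); split.
  rewrite /supernodes -!size_filter -size_cat; apply: uniq_leq_size.
    have /= /andP[Tq uq] := cyc_uniq C.
    rewrite cat_uniq filter_uniq ?iota_uniq // uq andbT; apply/hasPn => z zq.
    have [zn rz _ _] := cyc_node C (mem_behead (zq : z \in behead (T :: q))).
    rewrite mem_filter (mg_rep M) ?(ltnW zn) // rz inE zq orbT negb_and.
    by apply/orP; left; apply: contraNneq Tq => ->.
  move=> z; rewrite mem_cat !mem_filter mem_iota add0n /= => /orP[/andP[]|zq].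
    move=> /eqP + zn; rewrite (mg_rep M (ltnW zn)) zn andbT.
    by case: ifP => [_ <-|_ ->]; rewrite ?rT.
  have [zn rz _ _] := cyc_node C (mem_behead (zq : z \in behead (T :: q))).
  by rewrite rz eqxx zn.
rewrite /unselected; set l := undup _; set l' := undup _.
rewrite -[(size l').+1]/(size (cls S T :: l')); apply: uniq_leq_size; first exact: undup_uniq.
move=> k /mem_unselected[u un [+ ->]]; rewrite inE (mg_cls M un).
case: ifP => h; first by rewrite eqxx.
rewrite (mg_sel M un) negb_and negbK => /orP[nsel|->//].
by apply/orP; right; apply/mem_unselected; exists u.
Qed.

(** Two levels make updates cheap: under a merge, [bv] changes by comparing two columns, and [bx]
    has to be recomputed for the merged supernode only. *)
Record best_ok (S : config) (bv : nat -> nat -> nat) (bx : nat -> nat) : Prop := BestOk {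
  bvP : forall x t, x <= n -> t < n -> rep S t = t ->
    [/\ bv x t < n, rep S (bv x t) = t &
        forall v, v < n -> rep S v = t -> (red S (x, bv x t) <= red S (x, v))%R];
  bxP : forall t, t < n -> rep S t = t ->
    [/\ bx t <= n, rep S (bx t) != t &
        forall x, x <= n -> rep S x != t ->
          (red S (bx t, bv (bx t) t) <= red S (x, bv x t))%R] }.

(** An event shifts the reduced weights of all arcs into a class by the same amount and a supernode
    lies in one class, so all comparisons keep their outcome and neither table changes. *)
Lemma best_event S S' x v Kp bv bx : wf S -> event_spec S S' x v (cls S v) Kp ->
  best_ok S bv bx -> best_ok S' bv bx.
Proof.
move=> wS E [B1 B2].
have redE y u : u < n -> red S' (y, u) =
    (red S (y, u) - (if cls S (rep S u) == cls S v then red S (x, v) else 0))%R.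
  by move=> un; rewrite /red /= (ev_off E) // cls_rep //; case: ifP => _ /=; rewrite /red /=; lra.
split=> [y t yn tn|t tn]; rewrite (ev_rep E) ?(ltnW tn) // => rt.
  have [h1 h2 h3] := B1 y t yn tn rt; split; rewrite ?(ev_rep E) ?(ltnW h1) // => u un.
  rewrite (ev_rep E) ?(ltnW un) // => ru; rewrite !redE // h2 ru lerD2r; exact: h3.
have [h1 h2 h3] := B2 t tn rt; split; rewrite ?(ev_rep E) // => y yn.
rewrite (ev_rep E) // => ry; have [b1 b2 _] := B1 y t yn tn rt.
have [c1 c2 _] := B1 (bx t) t h1 tn rt.
by rewrite !redE // b2 c2 lerD2r; apply: h3.
Qed.

Lemma best_minimal S bv bx K T : wf S -> best_ok S bv bx ->
  T < n -> rep S T = T ->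
  (forall u, u < n -> cls S u = K ->
    (red S (bx T, bv (bx T) T) <= red S (bx (rep S u), bv (bx (rep S u)) (rep S u)))%R) ->
  forall a, is_arc a -> active S a -> cls S a.2 = K ->
    (red S (bx T, bv (bx T) T) <= red S a)%R.
Proof.
move=> wS [B1 B2] Tn rT mini [x v] /andP[/= xn vn] act cK.
have rv := rep_lt wS vn; have ri := rep_idem wS vn.
apply: le_trans (mini v vn cK) _.
have [h1 h2 h3] := B2 _ rv ri; have [_ _ h4] := B1 x _ xn rv ri.
by apply: le_trans (h3 x xn act) _; apply: h4.
Qed.

End Contraction.

(** * The program *)

(* Natural-number arrays: 2 classes, 4 supernodes, 5 and 6 best arcs, 7-9 selected
   arcs of the classes, 10-13 events, 14 chosen heads; scalars from 15 on. *)
Local Notation aN := 0 (only parsing). Local Notation aAdj := 1 (only parsing). Local Notation aCls := 2 (only parsing). Local Notation aOut := 3 (only parsing).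
Local Notation aRep := 4 (only parsing). Local Notation aBv := 5 (only parsing). Local Notation aBx := 6 (only parsing).
Local Notation aSel := 7 (only parsing). Local Notation aSelx := 8 (only parsing). Local Notation aSelT := 9 (only parsing).
Local Notation aMem := 10 (only parsing). Local Notation aEvx := 11 (only parsing). Local Notation aEvv := 12 (only parsing). Local Notation aE := 13 (only parsing).
Local Notation aChosen := 14 (only parsing).
Local Notation vI := 15 (only parsing). Local Notation vJ := 16 (only parsing). Local Notation vF := 17 (only parsing). Local Notation vK := 18 (only parsing).
Local Notation vT := 19 (only parsing). Local Notation vX := 20 (only parsing). Local Notation vV := 21 (only parsing). Local Notation vY := 22 (only parsing).
Local Notation vZ := 23 (only parsing). Local Notation vC := 24 (only parsing). Local Notation vB := 25 (only parsing).
Local Notation rW := 0 (only parsing). Local Notation rOff := 1 (only parsing). Local Notation rM := 2 (only parsing). Local Notation rLam := 3 (only parsing).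

Declare Scope prog_scope.
Local Notation "p ;; q" := (Seq p q) (at level 60, right associativity) : prog_scope.
Local Open Scope prog_scope.

Definition rvec (x : nat) (e : nexpr) : rexpr := RGet x e (NConst 0).
Definition rscal (x : nat) : rexpr := RGet x (NConst 0) (NConst 0).

(* Reduced weight of the best arc from [x] into the supernode [t]. *)
Definition best_red (x t : nexpr) : rexpr :=
  RSub (RGet rW x (NGet aBv x t)) (rvec rOff (NGet aBv x t)).

Definition find_unselected : program :=
  set_scal vF (scal aN) ;;
  for_loop vI (scal aN)
    (If (NEq (vec aSel (vec aCls (scal vI))) (NConst 0)) (set_scal vF (scal vI)) Skip).

(** The initial candidate is the source, which lies outside every supernode of nodes. *)
Definition compute_best : program :=
  set_scal vB (scal aN) ;;
  for_loop vJ (scal aN)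
    (If (BAnd (nneq (vec aRep (scal vJ)) (scal vT))
              (rlt (best_red (scal vJ) (scal vT)) (best_red (scal vB) (scal vT))))
        (set_scal vB (scal vJ)) Skip) ;;
  set_vec aBx (scal vT) (scal vB).

Definition best_supernode : program :=
  set_scal vK (vec aCls (scal vF)) ;;
  set_scal vT (vec aRep (scal vF)) ;;
  for_loop vI (scal aN)
    (If (BAnd (NEq (vec aCls (scal vI)) (scal vK))
              (rlt (best_red (vec aBx (vec aRep (scal vI))) (vec aRep (scal vI)))
                   (best_red (vec aBx (scal vT)) (scal vT))))
        (set_scal vT (vec aRep (scal vI))) Skip).

Definition select_arc : program :=
  set_scal vX (vec aBx (scal vT)) ;;
  set_scal vV (NGet aBv (scal vX) (scal vT)) ;;
  RSet rLam (NConst 0) (NConst 0) (best_red (scal vX) (scal vT)) ;;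
  set_vec aEvx (scal aE) (scal vX) ;;
  set_vec aEvv (scal aE) (scal vV) ;;
  set_vec aSel (scal vK) (NConst 1) ;;
  set_vec aSelx (scal vK) (scal vX) ;;
  set_vec aSelT (scal vK) (scal vT).

Definition record_event : program :=
  select_arc ;;
  for_loop vI (scal aN)
    (If (NEq (vec aCls (scal vI)) (scal vK))
        (NSet aMem (scal aE) (scal vI) (NConst 1) ;;
         RSet rOff (scal vI) (NConst 0) (RAdd (rvec rOff (scal vI)) (rscal rLam)))
        (NSet aMem (scal aE) (scal vI) (NConst 0))) ;;
  set_scal aE (NAdd (scal aE) (NConst 1)).

Definition parent_expr (y : nexpr) : nexpr := vec aRep (vec aSelx (vec aCls y)).

Definition walk_back : program :=
  set_scal vY (vec aRep (scal vX)) ;;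
  for_loop vI (scal aN)
    (If (BAnd (nneq (scal vY) (scal aN))
        (BAnd (nneq (scal vY) (scal vT))
        (BAnd (nneq (vec aSel (vec aCls (scal vY))) (NConst 0))
              (NEq (vec aSelT (vec aCls (scal vY))) (scal vY)))))
        (set_scal vY (parent_expr (scal vY))) Skip).

(** [vZ] and [vC] are saved first, because the second loop overwrites the class and the
    representative of [vY]. The first loop has one more round, for the arcs leaving the source. *)
Definition merge_one : program :=
  set_scal vZ (parent_expr (scal vY)) ;;
  set_scal vC (vec aCls (scal vY)) ;;
  for_loop vI (NAdd (scal aN) (NConst 1))
    (If (rlt (best_red (scal vI) (scal vY)) (best_red (scal vI) (scal vT)))
        (NSet aBv (scal vI) (scal vT) (NGet aBv (scal vI) (scal vY))) Skip) ;;
  for_loop vI (scal aN)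
    (If (NEq (vec aRep (scal vI)) (scal vY)) (set_vec aRep (scal vI) (scal vT)) Skip ;;
     If (NEq (vec aCls (scal vI)) (scal vC)) (set_vec aCls (scal vI) (scal vK)) Skip) ;;
  set_scal vY (scal vZ).

Definition merge_cycle : program :=
  set_scal vY (vec aRep (scal vX)) ;;
  While (nneq (scal vY) (scal vT)) merge_one ;;
  set_vec aSel (scal vK) (NConst 0) ;;
  compute_best.

Definition phase : program :=
  best_supernode ;; record_event ;; walk_back ;;
  If (NEq (scal vY) (scal vT)) merge_cycle Skip.

Definition contract : program :=
  find_unselected ;;
  While (nneq (scal vF) (scal aN)) (phase ;; find_unselected).

(** Squares stand in for absolute values: [1 + x^2 >= 2 |x|], so the sum exceeds [2 * sum |w|]
    without a test of signs. *)
Definition init_bound : program :=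
  RSet rM (NConst 0) (NConst 0) (RConst 1) ;;
  for_loop vI (scal aN)
    (for_loop vJ (scal aN)
       (RSet rM (NConst 0) (NConst 0)
          (RAdd (rscal rM)
             (RAdd (RConst 1)
                (RMul (RGet rW (scal vI) (scal vJ)) (RGet rW (scal vI) (scal vJ))))))).

(** Row [n] of the adjacency matrix is zero, so arcs from the source get [2 M] like the completing
    ones; column [n] is left alone, as nothing enters the source. *)
Definition init_weights : program :=
  for_loop vI (NAdd (scal aN) (NConst 1))
    (set_vec aRep (scal vI) (scal vI) ;;
     for_loop vJ (scal aN)
       (If (NEq (NGet aAdj (scal vI) (scal vJ)) (NConst 0))
           (RSet rW (scal vI) (scal vJ) (RAdd (rscal rM) (rscal rM)))
           (RSet rW (scal vI) (scal vJ)
              (RAdd (RGet rW (scal vI) (scal vJ)) (rscal rM))) ;;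
        NSet aBv (scal vI) (scal vJ) (scal vJ))).

Definition init_best : program :=
  for_loop vT (scal aN) compute_best.

(** Storing the adjacency entry instead of 1 drops source arcs and completing arcs from the output.
    The flag [vF] tells whether the class of the event already has a chosen head. *)
Definition expand_events : program :=
  set_scal vI (scal aE) ;;
  While (nlt (NConst 0) (scal vI))
    (set_scal vI (NSub (scal vI) (NConst 1)) ;;
     set_scal vF (NConst 0) ;;
     for_loop vJ (scal aN)
       (If (BAnd (nneq (NGet aMem (scal vI) (scal vJ)) (NConst 0))
                 (nneq (vec aChosen (scal vJ)) (NConst 0)))
           (set_scal vF (NConst 1)) Skip) ;;
     If (NEq (scal vF) (NConst 0))
        (set_vec aChosen (vec aEvv (scal vI)) (NConst 1) ;;
         NSet aOut (vec aEvx (scal vI)) (vec aEvv (scal vI))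
           (NGet aAdj (vec aEvx (scal vI)) (vec aEvv (scal vI))))
        Skip).

Definition branching_program : program :=
  init_bound ;; init_weights ;; init_best ;; contract ;; expand_events.

(** * Specifications of the loops of a phase *)

Section Loops.
Variables (R : realType) (n : nat).
Implicit Types st : state R.

Definition conf st : config R :=
  Config (fun u => nmem st aCls u 0) (fun u => nmem st aRep u 0)
    (fun k => nmem st aSel k 0 != 0) (fun k => nmem st aSelx k 0)
    (fun k => nmem st aSelT k 0) (fun u => rmem st rOff u 0).

Definition bv st x t := nmem st aBv x t.
Definition bx st t := nmem st aBx t 0.

Lemma find_unselected_spec st : nmem st aN 0 0 = n ->
  wp find_unselected (60 * n.+1)
    (fun st' => if nmem st' vF 0 0 == n
       then forall u, u < n -> sel (conf st) (cls (conf st) u)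
       else nmem st' vF 0 0 < n /\ ~~ sel (conf st) (cls (conf st) (nmem st' vF 0 0))) st.
Proof.
move=> nE.
apply: (@wp_seq_run _ _ _ (54 * n.+1)) => //; last by rewrite /=; lia.
move=> st1 [fr _] st1E.
have F1 : nmem st1 vF 0 0 = n by rewrite st1E.
apply: (@wp_for_frame _ _ _ _ (fun k st' => if nmem st' vF 0 0 == n
       then forall u, u < k -> sel (conf st) (cls (conf st) u)
       else nmem st' vF 0 0 < n /\ ~~ sel (conf st) (cls (conf st) (nmem st' vF 0 0))) n 30) => //=.
- by rewrite /update /= F1 eqxx.
- by move=> st2 [fr2 _] /=; rewrite fr2 // fr.
- move=> k st2 kn [fr2 _] I2 ik; apply: wp_run => //=.
  rewrite ik !fr2 // !fr //; have [h|h] := eqVneq (nmem st aSel (nmem st aCls k 0) 0) 0.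
    by rewrite /update /= ltn_eqF // kn h.
  rewrite /update /=; case: (nmem st2 _ 0 0 == n) I2 => // I2 u.
  by rewrite ltnS leq_eqVlt => /predU1P[->|]; [rewrite /= h | apply: I2].
- lia.
Qed.

Local Notation redS st := (red (rmem st rW) (conf st)).

Lemma compute_best_spec st t : nmem st aN 0 0 = n -> nmem st vT 0 0 = t ->
  rep (conf st) n != t ->
  wp compute_best (150 * n.+1)
    (fun st' => exists b, [/\ b <= n, rep (conf st) b != t,
       forall x, x <= n -> rep (conf st) x != t ->
         (redS st (b, bv st b t) <= redS st (x, bv st x t))%R
     & forall u, bx st' u = if u == t then b else bx st u]) st.
Proof.
move=> nE tE nt.
apply: (@wp_seq_run _ _ _ (140 * n.+1)) => //; last by rewrite /=; lia.
move=> st1 [fr frr] st1E; have F1 : nmem st1 vB 0 0 = n by rewrite st1E.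
(* The disjunct [x == n] is there because the scan starts with the source as candidate. *)
apply: (@wp_seq _ _ _ (120 * n.+1) 10 _ (fun st' => [/\ nmem st' vB 0 0 <= n,
    rep (conf st) (nmem st' vB 0 0) != t &
    forall x, (x < n) || (x == n) -> rep (conf st) x != t ->
      (redS st (nmem st' vB 0 0, bv st (nmem st' vB 0 0) t) <= redS st (x, bv st x t))%R])); last by lia.
  apply: (@wp_for_frame _ _ _ _ (fun k st' => [/\ nmem st' vB 0 0 <= n,
    rep (conf st) (nmem st' vB 0 0) != t &
    forall x, (x < k) || (x == n) -> rep (conf st) x != t ->
      (redS st (nmem st' vB 0 0, bv st (nmem st' vB 0 0) t) <= redS st (x, bv st x t))%R]) n 100) => //=.
  - rewrite /update /= F1; split=> // x /eqP-> //.
  - by move=> st2 [fr2 _] /=; rewrite fr2 // fr.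
  - move=> k st2 kn [fr2 frr2] [I1 I2 I3] ik.
    have cE : beval st2 (BAnd (nneq (vec aRep (scal vJ)) (scal vT))
              (rlt (best_red (scal vJ) (scal vT)) (best_red (scal vB) (scal vT)))) =
       (rep (conf st) k != t) && (redS st (k, bv st k t) <
          redS st (nmem st2 vB 0 0, bv st (nmem st2 vB 0 0) t))%R.
      rewrite /= ik !(fr2 aRep isT, fr2 aBv isT, fr2 vT isT, frr2 rW isT, frr2 rOff isT).
      by rewrite !(fr aRep isT, fr aBv isT, fr vT isT, frr rW isT, frr rOff isT) tE -ltNge.
    apply: (@wp_if _ _ _ _ 6) => //; rewrite cE => h.
      have /andP[h1 h2] := h.
      apply: wp_run => //=; rewrite /update /= ik; split; rewrite ?(ltnW kn) //.
      move=> x; rewrite ltnS leq_eqVlt -orbA => /predU1P[->//|h3] rx.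
      by apply: le_trans (ltW h2) _; apply: I3.
    apply: wp_run => //=; rewrite /update /=; split=> // x.
    rewrite ltnS leq_eqVlt -orbA => /predU1P[->|]; last exact: I3.
    by move=> h1; move: h; rewrite h1 /= -leNgt.
  - lia.
move=> st2 [fr2 frr2] [I1 I2 I3]; apply: wp_run => //=.
exists (nmem st2 vB 0 0); split=> //.
  by move=> x; rewrite leq_eqVlt orbC; apply: I3.
by move=> u; rewrite /update /bx /= !(fr2 aBx isT, fr2 vT isT) !(fr aBx isT, fr vT isT) tE andbT.
Qed.

Lemma best_supernode_spec st : nmem st aN 0 0 = n -> nmem st vF 0 0 < n ->
  wf n (conf st) ->
  wp best_supernode (150 * n.+1)
    (fun st' => let T := nmem st' vT 0 0 in
     [/\ T < n, rep (conf st) T = T, nmem st' vK 0 0 = cls (conf st) (nmem st vF 0 0),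
       cls (conf st) T = cls (conf st) (nmem st vF 0 0)
     & forall u, u < n -> cls (conf st) u = cls (conf st) (nmem st vF 0 0) ->
         (redS st (bx st T, bv st (bx st T) T) <=
          redS st (bx st (rep (conf st) u), bv st (bx st (rep (conf st) u)) (rep (conf st) u)))%R]) st.
Proof.
move=> nE fn wS; set f := nmem st vF 0 0 in fn *; set K := cls (conf st) f.
apply: (@wp_seq_run _ _ _ (140 * n.+1)) => //; last by rewrite /=; lia.
move=> st1 [fr frr] st1E; have F1 : nmem st1 vK 0 0 = K by rewrite st1E.
apply: (@wp_seq_run _ _ _ (130 * n.+1)) => //; last by rewrite /=; lia.
move=> st2 [fr2 frr2] st2E.
have F2 : nmem st2 vT 0 0 = rep (conf st) f by rewrite st2E /= /update /= !fr.
pose I k st' := let T := nmem st' vT 0 0 in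
  [/\ T < n, rep (conf st) T = T, cls (conf st) T = K &
    forall u, u < k -> cls (conf st) u = K ->
         (redS st (bx st T, bv st (bx st T) T) <=
          redS st (bx st (rep (conf st) u), bv st (bx st (rep (conf st) u)) (rep (conf st) u)))%R].
apply: (@wp_weaken _ _ (130 * n.+1) _ (I n)) => //; last first.
  move=> st3 [fr3 _] [h1 h2 h3 h4]; split=> //.
  by rewrite fr3 // fr2.
apply: (@wp_for_frame _ _ _ _ I n 100) => //=.
- rewrite /I /= /update /= F2; split=> //; first exact: (rep_lt wS fn).
    exact: (rep_idem wS fn).
  exact: (cls_rep wS fn).
- by move=> st3 [fr3 _] /=; rewrite fr3 // fr2 // fr.
- move=> k st3 kn [fr3 frr3] [I1 I2 I3 I4] ik.
  have cE : beval st3 (BAnd (NEq (vec aCls (scal vI)) (scal vK))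
              (rlt (best_red (vec aBx (vec aRep (scal vI))) (vec aRep (scal vI)))
                   (best_red (vec aBx (scal vT)) (scal vT)))) =
       (cls (conf st) k == K) && (
          redS st (bx st (rep (conf st) k), bv st (bx st (rep (conf st) k)) (rep (conf st) k)) <
          redS st (bx st (nmem st3 vT 0 0), bv st (bx st (nmem st3 vT 0 0)) (nmem st3 vT 0 0)))%R.
    rewrite /= ik !(fr3 aRep isT, fr3 aBv isT, fr3 aBx isT, fr3 aCls isT, fr3 vK isT, frr3 rW isT, frr3 rOff isT).
    rewrite !(fr2 aRep isT, fr2 aBv isT, fr2 aBx isT, fr2 aCls isT, fr2 vK isT, frr2 rW isT, frr2 rOff isT).
    by rewrite !(fr aRep isT, fr aBv isT, fr aBx isT, fr aCls isT, frr rW isT, frr rOff isT) F1 -ltNge.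
  apply: (@wp_if _ _ _ _ 8) => //; rewrite cE => h.
    have /andP[/eqP h1 h2] := h.
    apply: wp_run => //=; rewrite /I /update /= ik (fr3 aRep isT) (fr2 aRep isT) (fr aRep isT).
    split; first exact: (rep_lt wS kn).
    + exact: (rep_idem wS kn).
    + by rewrite -h1; apply: (cls_rep wS kn).
    + move=> x; rewrite ltnS leq_eqVlt => /predU1P[->//|h3] rx.
      by apply: le_trans (ltW h2) _; apply: I4.
  apply: wp_run => //=; rewrite /I /update /=; split=> // x.
  rewrite ltnS leq_eqVlt => /predU1P[->|]; last exact: I4.
  by move=> h1; move: h; rewrite (h1 : cls (conf st) k = K) eqxx /= -leNgt.
- lia.
Qed.

Definition event_at st e : event :=
  (fun u => nmem st aMem e u != 0, (nmem st aEvx e 0, nmem st aEvv e 0)).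

Definition history st : seq event :=
  [seq event_at st e | e <- rev (iota 0 (nmem st aE 0 0))].

Lemma record_event_spec st : nmem st aN 0 0 = n ->
  let T := nmem st vT 0 0 in let K := nmem st vK 0 0 in let E := nmem st aE 0 0 in
  let x := bx st T in let v := bv st x T in
  rep (conf st) v = T -> cls (conf st) v = K ->
  wp record_event (200 * n.+1)
    (fun st' => [/\ event_spec n (rmem st rW) (conf st) (conf st') x v K
         (fun u => nmem st' aMem E u != 0),
       nmem st' aE 0 0 = E.+1,
       history st' = (fun u => nmem st' aMem E u != 0, (x, v)) :: history st
     & nmem st' vX 0 0 = x]) st.
Proof.
move=> nE T K E x v rv cv.
pose lam := redS st (x, v).
apply: (@wp_seq_run _ _ _ (100 * n.+1)) => //; last by rewrite /=; lia.
move=> st1 [fr frr] st1E.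
have [F1 F2 F3 F4] : [/\ nmem st1 vX 0 0 = x, rmem st1 rLam 0 0 = lam,
    nmem st1 aEvx = update (nmem st) aEvx E 0 x aEvx &
    nmem st1 aEvv = update (nmem st) aEvv E 0 v aEvv] by rewrite st1E.
have [F5 F6 F7] : [/\ nmem st1 aSel = update (nmem st) aSel K 0 1 aSel,
    nmem st1 aSelx = update (nmem st) aSelx K 0 x aSelx &
    nmem st1 aSelT = update (nmem st) aSelT K 0 T aSelT] by rewrite st1E.
have {st1E} frE := (fr aN isT, fr aCls isT, fr aRep isT, fr vK isT, fr aE isT, fr aMem isT, frr rOff isT).
(* The last clause preserves the rows of older events, so that the history only grows at its
   head. *)
pose I k st' := [/\ forall u, rmem st' rOff u 0 =
      if (u < k) && (cls (conf st) u == K) then (off (conf st) u + lam)%R else off (conf st) u,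
    forall u, u < k -> (nmem st' aMem E u != 0) = (cls (conf st) u == K)
  & forall e, e != E -> nmem st' aMem e = nmem st aMem e].
apply: (@wp_seq _ _ _ (90 * n.+1) 10 _ (I n)); last by lia.
  apply: (@wp_for_frame _ _ _ _ I n 65) => //.
  - by split=> [u|u|e _] //=; rewrite /update /= frE.
  - by move=> st2 [fr2 _] /=; rewrite (fr2 aN isT) frE.
  - move=> k st2 kn [fr2 frr2] [I1 I2 I3] ik.
    have fr2E := (fr2 aCls isT, fr2 vK isT, fr2 aE isT, frr2 rLam isT, F2, frE).
    apply: wp_run => //=; rewrite ik !fr2E -/K -/E.
    have lt_k u : (u < k.+1) = (u == k) || (u < k) by rewrite ltnS leq_eqVlt.
    have [h|h] := eqVneq (nmem st aCls k 0) K; split=> [u|u|e nE'] /=; rewrite /update /= ?eqxx ?andbT /=.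
    + by rewrite ik !I1 lt_k; case: (eqVneq u k) => [->|_] //=; rewrite h eqxx ltnn.
    + by rewrite lt_k; case: (eqVneq u k) => [->|_] //=; [rewrite h eqxx | apply: I2].
    + by rewrite (negbTE nE') /= I3.
    + by rewrite !I1 lt_k; case: (eqVneq u k) => [->|_] //=; rewrite (negbTE h) andbF.
    + by rewrite lt_k; case: (eqVneq u k) => [->|_] //=; [rewrite (negbTE h) | apply: I2].
    + by rewrite (negbTE nE') /= I3.
  - rewrite /=; lia.
move=> st2 [fr2 frr2] [I1 I2 I3]; apply: wp_run => //.
have {fr2 frr2} fr2E := (fr2 aCls isT, fr2 vK isT, fr2 aE isT, fr2 aRep isT, fr2 vX isT,
  fr2 aEvx isT, fr2 aEvv isT, fr2 aSel isT, fr2 aSelx isT, fr2 aSelT isT,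
  F1, F3, F4, F5, F6, F7, frE).
have memE u : u < n -> (nmem st2 aMem E u != 0) = (cls (conf st) u == K) by exact: I2.
split.
- split=> /= [u un|u un|u un|u un|u un|||u un|u un]; rewrite /conf /update /= ?fr2E //.
  + by rewrite /update /= andbT orbC; case: (nmem st aCls u 0 == K).
  + by move=> nK; rewrite /update /= (negbTE nK).
  + by move=> nK; rewrite /update /= (negbTE nK).
  + by rewrite /update /= eqxx.
  + by rewrite /update /= eqxx.
  + by rewrite I1 un.
  + exact: memE.
- by rewrite /= /update /= !fr2E addn1.
- rewrite /history /= /update /= !fr2E addn1 -/E -[E.+1]addn1 iotaD rev_cat /= /event_at /=.
  rewrite !fr2E /update /= !eqxx; congr cons; apply/eq_in_map => e.
  rewrite mem_rev mem_iota add0n => /andP[_ eE]; rewrite /event_at /= ?fr2E /update /=.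
  by rewrite ltn_eqF //= I3 // ltn_eqF.
- by rewrite /= /update /= !fr2E.
Qed.

Lemma walk_back_spec st : nmem st aN 0 0 = n ->
  wp walk_back (150 * n.+1)
    (fun st' => nmem st' vY 0 0 =
       iter n (wstep n (conf st) (nmem st vT 0 0)) (rep (conf st) (nmem st vX 0 0))) st.
Proof.
move=> nE; set T := nmem st vT 0 0; set y0 := rep _ _.
apply: (@wp_seq_run _ _ _ (140 * n.+1)) => //; last by rewrite /=; lia.
move=> st1 [fr frr] st1E; have F1 : nmem st1 vY 0 0 = y0 by rewrite st1E.
have {st1E} frE := (fr aN isT, fr aCls isT, fr aRep isT, fr vT isT, fr aSel isT,
  fr aSelx isT, fr aSelT isT).
apply: (@wp_for_frame _ _ _ _ (fun k st' =>
  nmem st' vY 0 0 = iter k (wstep n (conf st) T) y0) n 80) => //.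
- by move=> st2 [fr2 _] /=; rewrite (fr2 aN isT) frE.
- move=> k st2 kn [fr2 frr2] I2 ik.
  have fr2E := (fr2 aN isT, fr2 aCls isT, fr2 aRep isT, fr2 vT isT, fr2 aSel isT,
    fr2 aSelx isT, fr2 aSelT isT, frE).
  have cE : beval st2 (BAnd (nneq (scal vY) (scal aN))
        (BAnd (nneq (scal vY) (scal vT))
        (BAnd (nneq (vec aSel (vec aCls (scal vY))) (NConst 0))
              (NEq (vec aSelT (vec aCls (scal vY))) (scal vY))))) =
     guard n (conf st) T (nmem st2 vY 0 0).
    by rewrite /= !fr2E nE.
  apply: (@wp_if _ _ _ _ 12) => //; rewrite cE I2 => h; apply: wp_run => //=;
    rewrite /update /= [in RHS]/wstep ?h ?(negbTE h) //.
  by rewrite !fr2E I2.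
- rewrite /=; lia.
Qed.

(* The state of the contraction once the supernodes in [q1] are merged into [T]. *)
Record merged st T q1 st' : Prop := Merged {
  md_rep : forall u, u <= n -> rep (conf st') u =
    if rep (conf st) u \in T :: q1 then T else rep (conf st) u;
  md_cls : forall u, u < n -> cls (conf st') u =
    if cls (conf st) u \in map (cls (conf st)) (T :: q1) then cls (conf st) T
    else cls (conf st) u;
  md_bv : forall x t, t != T -> bv st' x t = bv st x t;
  md_bvT : forall x, x <= n ->
    [/\ bv st' x T < n, rep (conf st) (bv st' x T) \in T :: q1 &
      forall v, v < n -> rep (conf st) v \in T :: q1 ->
        (redS st (x, bv st' x T) <= redS st (x, v))%R] }.

(** For each tail, the best head in the union is the better of the two old ones. Reduced weights are
    compared, since the two classes may carry different offsets. *)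
Lemma merge_one_spec st st1 T q1 y q2 : nmem st aN 0 0 = n -> wf n (conf st) ->
  (forall x t, x <= n -> t < n -> rep (conf st) t = t ->
    [/\ bv st x t < n, rep (conf st) (bv st x t) = t &
        forall v, v < n -> rep (conf st) v = t ->
          (redS st (x, bv st x t) <= redS st (x, v))%R]) ->
  cycle_ok n (conf st) T (T :: q1 ++ y :: q2) ->
  frame merge_one st st1 -> merged st T q1 st1 ->
  nmem st1 vT 0 0 = T -> nmem st1 vK 0 0 = cls (conf st) T -> nmem st1 vY 0 0 = y ->
  wp merge_one (250 * n.+1)
    (fun st' => merged st T (rcons q1 y) st' /\ nmem st' vY 0 0 = head T q2) st1.
Proof.
move=> nE wS BV C [fr0 frr0] M1 tE kE yE.
have [Tn rT sT eT] := cyc_node C (cyc_T C).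
have yc : y \in T :: q1 ++ y :: q2 by rewrite inE mem_cat mem_head !orbT.
have [yn ry sy ey] := cyc_node C yc.
have ynot : y \notin T :: q1.
  by have := cyc_uniq C; rewrite -cat_cons cat_uniq => /and3P[_ /hasPn/(_ y (mem_head _ _))].
have yT : y != T by apply: contraNneq ynot => ->; apply: mem_head.
have cynot : cls (conf st) y \notin map (cls (conf st)) (T :: q1).
  have := mc_uniq C; rewrite -cat_cons map_cat cat_uniq => /and3P[_ /hasPn h _].
  by apply: h; apply: mem_head.
have cyT : cls (conf st) y != cls (conf st) T.
  by apply: contraNneq cynot => ->; apply: mem_head.
have Cq z : z \in T :: q1 -> z < n /\ z \in T :: q1 ++ y :: q2.
  move=> zq; have zc : z \in T :: q1 ++ y :: q2 by rewrite -cat_cons mem_cat zq.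
  by have [] := cyc_node C zc.
have nnot : n \notin T :: q1 by apply/negP => /Cq[]; rewrite ltnn.
have par_y : par (conf st) y = head T q2.
  have /= := cyc_cycle C; rewrite rcons_cat cat_path => /andP[_ /= /andP[_]].
  by case: (q2) => [|y' q] /= /andP[/eqP].
have cls1y : cls (conf st1) y = cls (conf st) y by rewrite (md_cls M1) // (negbTE cynot).
(* The next supernode of the cycle is not absorbed yet and keeps its representative; if none is
   left, the parent is [T], which ends the loop. *)
have next1 : rep (conf st1) (selx (conf st1) (cls (conf st1) y)) = head T q2.
  have [xn _ _ _] := sel_wf wS yn sy.
  rewrite cls1y (_ : selx (conf st1) = selx (conf st)); last by rewrite /= (fr0 aSelx isT).
  rewrite (md_rep M1) // -/(par (conf st) y) par_y.
  case: (q2) C => [|y' q] C /=; first by rewrite mem_head.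
  case: ifP => // y'q; have := cyc_uniq C; rewrite -cat_cons cat_uniq => /and3P[_ /hasPn h _].
  by have := h y'; rewrite /= !inE eqxx orbT /= => /(_ isT); rewrite -in_cons y'q.
have memq z : (z \in T :: rcons q1 y) = (z \in T :: q1) || (z == y).
  by rewrite -rcons_cons mem_rcons inE orbC.
have memcq k : (k \in map (cls (conf st)) (T :: rcons q1 y)) =
    (k \in map (cls (conf st)) (T :: q1)) || (k == cls (conf st) y).
  by rewrite -rcons_cons map_rcons mem_rcons inE orbC.
have frE0 := (fr0 aN isT, frr0 rW isT, frr0 rOff isT).
apply: (@wp_seq_run _ _ _ (240 * n.+1)) => //; last by rewrite /=; lia.
move=> st2 [fr2 frr2] st2E.
have F2 : nmem st2 vZ 0 0 = head T q2 by rewrite st2E /= /update /= yE -next1.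
have {st2E} fr2E := (fr2 aN isT, fr2 aCls isT, fr2 aRep isT, fr2 aBv isT, fr2 vT isT,
  fr2 vK isT, fr2 vY isT, frr2 rW isT, frr2 rOff isT, F2).
apply: (@wp_seq_run _ _ _ (230 * n.+1)) => //; last by rewrite /=; lia.
move=> st3 [fr3 frr3] st3E.
have F3 : nmem st3 vC 0 0 = cls (conf st) y.
  by rewrite st3E /= /update /= !fr2E yE; apply: cls1y.
have {st3E} fr3E := (fr3 aN isT, fr3 aCls isT, fr3 aRep isT, fr3 aBv isT, fr3 vT isT,
  fr3 vK isT, fr3 vY isT, fr3 vZ isT, frr3 rW isT, frr3 rOff isT, F3, fr2E).
pose better x := (redS st (x, bv st x y) < redS st (x, bv st1 x T))%R.
pose I k st' := forall x t, bv st' x t =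
  if [&& x < k, t == T & better x] then bv st x y else bv st1 x t.
apply: (@wp_seq _ _ _ (120 * n.+1) (110 * n.+1) _ (I n.+1)); last by lia.
  apply: (@wp_for_frame _ _ _ _ I n.+1 90) => //.
  - by move=> x t; rewrite /bv /= /update /= !fr3E.
  - by move=> st4 [fr4 _] /=; rewrite (fr4 aN isT) !fr3E frE0 nE addn1.
  - move=> k st4 kn [fr4 frr4] I4 ik.
    have fr4E := (fr4 vT isT, fr4 vY isT, frr4 rW isT, frr4 rOff isT, fr3E, frE0).
    have bvy : bv st4 k y = bv st k y by rewrite I4 (negbTE yT) andbF (md_bv M1).
    have bvT : bv st4 k T = bv st1 k T by rewrite I4 ltnn.
    have cE : beval st4 (rlt (best_red (scal vI) (scal vY)) (best_red (scal vI) (scal vT)))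
      = better k.
      rewrite /= ik !fr4E tE yE -[nmem st4 _ k y]/(bv st4 k y) -[nmem st4 _ k T]/(bv st4 k T).
      by rewrite bvy bvT -ltNge.
    have lt_k u : (u < k.+1) = (u == k) || (u < k) by rewrite ltnS leq_eqVlt.
    apply: (@wp_if _ _ _ _ 20) => //; rewrite cE => h; apply: wp_run => //= x t.
      rewrite /bv /update /= ik !fr4E tE yE (bvy : nmem st4 aBv k y = _).
      rewrite /update /= (I4 x t : nmem st4 aBv x t = _) lt_k; case: (eqVneq x k) => [->|_] //=.
      by rewrite ltnn h andbT; case: eqP.
    rewrite /bv /nset /update /= (I4 x t : nmem st4 aBv x t = _) lt_k; case: (eqVneq x k) => [->|_] //=.
    by rewrite ltnn (negbTE h) andbF.
  - rewrite /=; lia.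
move=> st4 [fr4 frr4] I4.
have fr4E := (fr4 aN isT, fr4 aCls isT, fr4 aRep isT, fr4 vT isT, fr4 vK isT,
  fr4 vY isT, fr4 vC isT, fr4 vZ isT, fr3E, frE0).
pose J k st' := (forall u, nmem st' aRep u 0 =
    if (u < k) && (nmem st1 aRep u 0 == y) then T else nmem st1 aRep u 0) /\
  (forall u, nmem st' aCls u 0 =
    if (u < k) && (nmem st1 aCls u 0 == cls (conf st) y) then cls (conf st) T
    else nmem st1 aCls u 0).
apply: (@wp_seq _ _ _ (100 * n.+1) 10 _ (J n)); last by lia.
  apply: (@wp_for_frame _ _ _ _ J n 70) => //.
  - by split=> u /=; rewrite /update /= !fr4E.
  - by move=> st5 [fr5 _] /=; rewrite (fr5 aN isT) !fr4E.
  - move=> k st5 kn [fr5 frr5] [J1 J2] ik.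
    have fr5E := (fr5 vT isT, fr5 vY isT, fr5 vK isT, fr5 vC isT, fr4E).
    have lt_k u : (u < k.+1) = (u == k) || (u < k) by rewrite ltnS leq_eqVlt.
    have J1k : nmem st5 aRep k 0 = nmem st1 aRep k 0 by rewrite J1 ltnn.
    have J2k : nmem st5 aCls k 0 = nmem st1 aCls k 0 by rewrite J2 ltnn.
    apply: (@wp_seq_run _ _ _ 40) => // st6 [fr6 frr6] st6E.
    have {st6E} K1 u : nmem st6 aRep u 0 =
        if (u < k.+1) && (nmem st1 aRep u 0 == y) then T else nmem st1 aRep u 0.
      rewrite st6E /= ik !fr5E J1k tE yE lt_k.
      have [h|h] := eqVneq (nmem st1 aRep k 0) y; rewrite /= /update /= ?ik J1;
      by case: (eqVneq u k) => [->|_] //=; rewrite ?h ?(negbTE h) ?eqxx ?ltnn ?fr5E ?tE.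
    have fr6E := (fr6 aCls isT, fr6 vI isT, fr6 vC isT, fr6 vK isT, fr5E).
    apply: wp_run => //=; rewrite !fr6E ik J2k.
    have [h|h] := eqVneq (nmem st1 aCls k 0) (cls (conf st) y); split=> u /=;
      rewrite /update /= ?fr6E ?ik ?K1 // J2 lt_k;
      by case: (eqVneq u k) => [->|_] //=; rewrite ?h ?(negbTE h) ?eqxx ?ltnn ?fr6E ?kE.
  - rewrite /=; lia.
move=> st5 [fr5 frr5] [J1 J2]; apply: wp_run => //=.
have bv5 x t : nmem st5 aBv x t = bv st4 x t by rewrite (fr5 aBv isT).
split; last by rewrite /update /= (fr5 vZ isT) !fr4E.
split=> [u un|u un|x t tT|x xn]; rewrite /bv /= /update /= ?bv5 ?I4.
- rewrite J1 (md_rep M1 un : nmem st1 aRep u 0 = _) memq.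
  move: un; rewrite leq_eqVlt => /predU1P[->|un].
    rewrite ltnn (rep_n wS : nmem st aRep n 0 = n) (negbTE nnot) /=.
    by rewrite (rep_n wS : nmem st aRep n 0 = n) (negbTE nnot) (gtn_eqF yn).
  rewrite un andTb; set w := nmem st aRep u 0; rewrite [rep (conf st) u](_ : _ = w) //.
  case: (w \in _) => //=.
  by rewrite eq_sym (negbTE yT).
- rewrite J2 (md_cls M1 un : nmem st1 aCls u 0 = _) memcq un andTb.
  set w := nmem st aCls u 0; rewrite [cls (conf st) u](_ : _ = w) //.
  case: (w \in _) => //=.
  by rewrite eq_sym (negbTE cyT).
- by rewrite (negbTE tT) andbF (md_bv M1).
- rewrite eqxx ltnS xn /=; have [b1 b2 b3] := BV x y xn yn ry.
  have [c1 c2 c3] := md_bvT M1 xn; case: ifP => h.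
    split=> //; first by rewrite memq; apply/orP; right; rewrite -[X in _ == X]b2.
    move=> v vn; rewrite memq => /orP[vq|/eqP vy]; last exact: b3.
    by apply: le_trans (ltW h) _; apply: c3.
  split=> //; first by rewrite memq; apply/orP; left.
  move=> v vn; rewrite memq => /orP[vq|/eqP vy]; first exact: c3.
  by apply: le_trans (b3 v vn vy); rewrite leNgt; apply/negbT.
Qed.

Lemma merge_cycle_spec st q : let T := nmem st vT 0 0 in
  nmem st aN 0 0 = n -> wf n (conf st) ->
  best_ok n (rmem st rW) (conf st) (bv st) (bx st) ->
  cycle_ok n (conf st) T (T :: q) -> nmem st vK 0 0 = cls (conf st) T ->
  rep (conf st) (nmem st vX 0 0) = head T q ->
  wp merge_cycle (500 * n.+1 * (size q).+1)
    (fun st' => merge_spec n (conf st) (conf st') T (T :: q) /\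
       best_ok n (rmem st rW) (conf st') (bv st') (bx st')) st.
Proof.
move=> T nE wS [B1 B2] C kE xE.
have [Tn rT sT eT] := cyc_node C (cyc_T C).
apply: (@wp_seq_run _ _ _ (250 * n.+1 * (size q).+1 + 20 * (size q).+1 + 160 * n.+1)) => //;
  last by rewrite /=; nia.
move=> st1 [fr1 frr1] st1E.
have fr1' : frame merge_one st st1.
  split=> x h; last exact: frr1.
  by apply: fr1; apply: contra h => /=; rewrite inE => /eqP->.
have F1 : nmem st1 vY 0 0 = head T q by rewrite st1E /= /update /= -xE.
have M0 : merged st T [::] st1.
  split=> [u un|u un|x t _|x xn].
  - by rewrite /= inE (fr1 aRep isT); case: eqP.
  - by rewrite /= inE (fr1 aCls isT); case: eqP => // ->.
  - by rewrite /bv (fr1 aBv isT).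
  - have [h1 h2 h3] := B1 x T xn Tn rT; rewrite /bv (fr1 aBv isT).
    split=> //; first by rewrite inE; apply/eqP.
    by move=> v vn; rewrite inE => /eqP; apply: h3.
pose I k st' := frame merge_one st st' /\ exists q1 q2,
  [/\ q = q1 ++ q2, k = size q2, merged st T q1 st' & nmem st' vY 0 0 = head T q2].
apply: (@wp_seq _ _ _ (250 * n.+1 * (size q).+1 + 20 * (size q).+1) (160 * n.+1) _
  (fun st' => frame merge_one st st' /\ merged st T q st')); last by lia.
  have := @wp_while _ (nneq (scal vY) (scal vT)) merge_one I (250 * n.+1) (size q) st1.
  move=> h; apply: wp_weaken (h _ _) _ _.
  - move=> k st2 [fr2 [q1 [[|y q2] [qE kE2 M2 yE]]]] /=.
      by rewrite yE (proj1 fr2 vT isT) eqxx.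
    move=> _; have Cq : cycle_ok n (conf st) T (T :: q1 ++ y :: q2) by rewrite -qE.
    have tE2 : nmem st2 vT 0 0 = T by rewrite (proj1 fr2 vT isT).
    have kE2' : nmem st2 vK 0 0 = cls (conf st) T by rewrite (proj1 fr2 vK isT).
    have [t [st3 [ex [lt [M3 yE3]]]]] := merge_one_spec nE wS B1 Cq fr2 M2 tE2 kE2' yE.
    exists t, st3; split=> //; exists (size q2); split; rewrite ?kE2 //=.
      by rewrite subSnn muln1.
    split; first exact: frame_trans fr2 (exec_frame ex).
    by exists (rcons q1 y), q2; rewrite cat_rcons.
  - by split=> //; exists [::], q.
  - rewrite /=; nia.
  - move=> st2 _ [nb [k [fr2 [q1 [[|y q2] [qE _ M2 yE]]]]]].
      by rewrite cats0 in qE; split=> //; rewrite qE.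
    move: nb; rewrite /= yE (proj1 fr2 vT isT) negbK => /eqP e.
    by have := cyc_uniq C; rewrite qE /= -(e : y = T) mem_cat mem_head orbT.
move=> st2 _ [[fr2 frr2] M2].
apply: (@wp_seq_run _ _ _ (150 * n.+1)) => //; last by rewrite /=; lia.
move=> st3 [fr3 frr3] st3E.
have F3 : nmem st3 aSel = update (nmem st) aSel (cls (conf st) T) 0 0 aSel.
  by rewrite st3E /= (fr2 vK isT) kE /update /= (fr2 aSel isT).
have rep3 : rep (conf st3) = rep (conf st2) by rewrite /= (fr3 aRep isT).
have cls3 : cls (conf st3) = cls (conf st2) by rewrite /= (fr3 aCls isT).
have n3 : nmem st3 aN 0 0 = n by rewrite (fr3 aN isT) (fr2 aN isT).
have T3 : nmem st3 vT 0 0 = T by rewrite (fr3 vT isT) (fr2 vT isT).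
have W3 : rmem st3 rW = rmem st rW by rewrite (frr3 rW isT) (frr2 rW isT).
have off3 : off (conf st3) = off (conf st) by rewrite /= (frr3 rOff isT) (frr2 rOff isT).
have bv3 : bv st3 = bv st2 by rewrite /bv (fr3 aBv isT).
have bx3 : bx st3 = bx st by rewrite /bx (fr3 aBx isT) (fr2 aBx isT).
have redE : redS st3 =1 redS st by move=> a; rewrite /red W3 off3.
have nnot : n \notin T :: q by apply/negP => /(cyc_node C)[]; rewrite ltnn.
have repT u : u <= n -> rep (conf st3) u = if rep (conf st) u \in T :: q then T else rep (conf st) u.
  by move=> un; rewrite rep3 (md_rep M2).
have n3T : rep (conf st3) n != T.
  rewrite repT // (rep_n wS) (negbTE nnot); by rewrite neq_ltn Tn orbT.
apply: wp_weaken (compute_best_spec n3 T3 n3T) (leqnn _) _ => st4 [fr4 frr4] [b [b1 b2 b3 b4]].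
have rep4 : rep (conf st4) = rep (conf st3) by rewrite /= (fr4 aRep isT).
have cls4 : cls (conf st4) = cls (conf st2) by rewrite -cls3 /= (fr4 aCls isT).
have off4 : off (conf st4) = off (conf st) by rewrite -off3 /= (frr4 rOff isT).
have bv4 : bv st4 = bv st2 by rewrite -bv3 /bv (fr4 aBv isT).
have red4 : red (rmem st rW) (conf st4) =1 redS st by move=> a; rewrite /red off4.
split.
  split=> u un; rewrite ?rep4 ?repT //.
  - by rewrite cls4 (md_cls M2).
  - rewrite /= (fr4 aSel isT) F3 /update /=.
    by case: (nmem st aCls u 0 == _); rewrite ?andbT ?andbF.
  - by rewrite /= (fr4 aSelx isT) (fr3 aSelx isT) (fr2 aSelx isT).
  - by rewrite /= (fr4 aSelT isT) (fr3 aSelT isT) (fr2 aSelT isT).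
  - by rewrite off4.
have reps t : t < n -> rep (conf st4) t = t -> t != T -> rep (conf st) t = t /\ t \notin T :: q.
  move=> tn; rewrite rep4 repT 1?ltnW //; case: ifP => [_ <-|h e _]; first by rewrite eqxx.
  by split=> //; rewrite -e h.
split=> [x t xn tn rt|t tn rt].
  rewrite bv4; have [->|tT] := eqVneq t T.
    have [c1 c2 c3] := md_bvT M2 xn; split=> //.
      by rewrite rep4 repT 1?ltnW // c2.
    move=> v vn; rewrite rep4 repT 1?ltnW // !red4 => rv; apply: c3 => //.
    by move: rv; case: ifP => // <- e; rewrite inE; apply/orP; left; apply/eqP.
  have [rt' tq] := reps t tn rt tT; rewrite (md_bv M2) //.
  have [c1 c2 c3] := B1 x t xn tn rt'; split=> //.
    by rewrite rep4 repT 1?ltnW // c2 (negbTE tq).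
  move=> v vn; rewrite rep4 repT 1?ltnW // !red4 => rv; apply: c3 => //.
  by move: rv; case: ifP => // _ e; rewrite e eqxx in tT.
rewrite b4 bv4; case: eqP => [->|/eqP tT].
  split; rewrite ?rep4 // => x xn; rewrite ?rep4 !red4 => rx.
  by have := b3 x xn rx; rewrite !redE bv3.
(* A supernode other than [T] is untouched, so the nodes outside it are the same as before and its
   best tail stays valid even if absorbed into [T]. *)
have [rt' tq] := reps t tn rt tT; rewrite !(md_bv M2) //.
have [c1 c2 c3] := B2 t tn rt'; rewrite bx3; split=> //.
  by rewrite rep4 repT //; case: ifP => // _; rewrite eq_sym.
move=> x xn; rewrite !red4 (md_bv M2) // rep4 repT // => rx; apply: c3 => //.
by apply: contraNneq rx => ->; rewrite (negbTE tq).
Qed.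

End Loops.

(** * One phase and its amortized cost *)

Section Phase.
Variables (R : realType) (n : nat).
Implicit Types st : state R.

Definition potential st : nat := supernodes n (conf st) + unselected n (conf st).

(** Each phase records one event and lowers the potential, so [mi_events] bounds the number of
    events by [2 n]. [mi_heads] serves the backward pass, which marks the heads. *)
Record main_inv (W : nat -> nat -> R) (S0 : config R) st : Prop := MainInv {
  mi_n : nmem st aN 0 0 = n;
  mi_W : rmem st rW = W;
  mi_inv : exists L, inv n W S0 (conf st) (history st) L;
  mi_acyclic : acyclic_but n (conf st) None;
  mi_best : best_ok n W (conf st) (bv st) (bx st);
  mi_heads : all (fun e : event => e.2.2 < n) (history st);
  mi_events : nmem st aE 0 0 + potential st <= 2 * n }.

Definition conf_arrays : seq nat := [:: aCls; aRep; aSel; aSelx; aSelT].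

Lemma conf_frame p st st' : frame p st st' ->
  all (fun x => x \notin modn p) conf_arrays -> rOff \notin modr p -> conf st' = conf st.
Proof. by move=> [fr frr] /and5P[h1 h2 h3 h4 /andP[h5 _]] h6; rewrite /conf !fr ?frr. Qed.

Lemma phase_spec W S0 st : main_inv W S0 st -> nmem st vF 0 0 < n ->
  ~~ sel (conf st) (cls (conf st) (nmem st vF 0 0)) ->
  wpt phase (fun t st' => [/\ main_inv W S0 st', potential st' < potential st &
    t <= 2000 * n.+1 * (potential st - potential st')]) st.
Proof.
move=> [nE WE [L I] ac B hd ev] fn nsel; set f := nmem st vF 0 0 in fn nsel.
have wS := inv_wf I; have [B1 B2] := B.
apply: wpt_seq (best_supernode_spec nE fn wS) _ => st1 fr1 Q1.
have {Q1} [Tn rT kE cT mini] := Q1; set T := nmem st1 vT 0 0 in Tn rT cT mini.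
have c1 : conf st1 = conf st by apply: conf_frame fr1 _ _.
have {fr1} [fr1 frr1] := fr1.
have bv1 : bv st1 = bv st by rewrite /bv (fr1 aBv isT).
have bx1 : bx st1 = bx st by rewrite /bx (fr1 aBx isT).
have n1 : nmem st1 aN 0 0 = n by rewrite (fr1 aN isT).
have h1 : history st1 = history st.
  by rewrite /history /event_at (fr1 aMem isT) (fr1 aEvx isT) (fr1 aEvv isT) (fr1 aE isT).
set K := cls (conf st) f in nsel kE cT mini.
pose x := bx st T; pose v := bv st x T.
have [xn rx _] := B2 T Tn rT; have [vn rv _] := B1 x T xn Tn rT.
have cv : cls (conf st) v = K by rewrite -(cls_rep wS vn) rv cT.
have rvT1 : rep (conf st1) (bv st1 (bx st1 (nmem st1 vT 0 0)) (nmem st1 vT 0 0)) = nmem st1 vT 0 0.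
  by rewrite c1 bv1 bx1.
have cvK1 : cls (conf st1) (bv st1 (bx st1 (nmem st1 vT 0 0)) (nmem st1 vT 0 0)) = nmem st1 vK 0 0.
  by rewrite c1 bv1 bx1 kE.
apply: wpt_seq (record_event_spec n1 rvT1 cvK1) _ => st2 [fr2 frr2].
rewrite (frr1 rW isT) WE c1 bv1 bx1 h1 kE -/T -/x -/v (fr1 aE isT).
set Kp := (fun u => _) => -[E e2 h2 x2].
rewrite -cv in E.
have axv : is_arc n (x, v) by rewrite /is_arc /= xn.
have act : active (conf st) (x, v) by rewrite /active [rep (conf st) _.2]rv.
have minK a : is_arc n a -> active (conf st) a -> cls (conf st) a.2 = cls (conf st) v ->
    (red W (conf st) (x, v) <= red W (conf st) a)%R.
  rewrite cv; apply: (best_minimal wS B Tn rT) => u un cu.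
  by have := mini u un cu; rewrite WE.
have nselv : ~~ sel (conf st) (cls (conf st) v) by rewrite cv.
have [I2 ac2] := event_step I ac axv act nselv minK E.
have B2' := best_event wS E B.
have [sup2 uns2] := event_potential vn nselv E.
have wS2 := inv_wf I2.
have n2 : nmem st2 aN 0 0 = n by rewrite (fr2 aN isT).
have T2 : nmem st2 vT 0 0 = T by rewrite (fr2 vT isT).
have K2 : nmem st2 vK 0 0 = K by rewrite (fr2 vK isT).
have bv2 : bv st2 = bv st by rewrite /bv (fr2 aBv isT) -[LHS]/(bv st1).
have bx2 : bx st2 = bx st by rewrite /bx (fr2 aBx isT) -[LHS]/(bx st1).
have W2 : rmem st2 rW = W by rewrite (frr2 rW isT) (frr1 rW isT).
apply: wpt_seq (walk_back_spec n2) _ => st3 fr3 y3.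
have c3 : conf st3 = conf st2 by apply: conf_frame fr3 _ _.
have {fr3} [fr3 frr3] := fr3.
have h3 : history st3 = history st2.
  by rewrite /history /event_at (fr3 aMem isT) (fr3 aEvx isT) (fr3 aEvv isT) (fr3 aE isT).
have bv3 : bv st3 = bv st by rewrite -bv2 /bv (fr3 aBv isT).
have bx3 : bx st3 = bx st by rewrite -bx2 /bx (fr3 aBx isT).
have n3 : nmem st3 aN 0 0 = n by rewrite (fr3 aN isT).
have T3 : nmem st3 vT 0 0 = T by rewrite (fr3 vT isT).
have K3 : nmem st3 vK 0 0 = K by rewrite (fr3 vK isT).
have W3 : rmem st3 rW = W by rewrite (frr3 rW isT).
have e3 : nmem st3 aE 0 0 = (nmem st aE 0 0).+1 by rewrite (fr3 aE isT).
have Tle := ltnW Tn.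
have rT2 : rep (conf st2) T = T by rewrite (ev_rep E).
have cT2 : cls (conf st2) T = K by rewrite (ev_cls E).
have cvK := cv.
have sT2 : sel (conf st2) (cls (conf st2) T).
  by rewrite cT2 -cT (ev_sel E) // cT cvK eqxx orbT.
have sTE2 : selT (conf st2) (cls (conf st2) T) = T by rewrite cT2 -cvK (ev_T E).
have parT : par (conf st2) T = rep (conf st2) x by rewrite /par cT2 -cvK (ev_x E).
have parnT : par (conf st2) T != T by rewrite parT (ev_rep E).
have ac2' : acyclic_but n (conf st2) (Some (cls (conf st2) T)) by rewrite cT2 -cvK.
rewrite x2 -parT T2 in y3.
have := walk_cases wS2 Tn rT2 sT2 sTE2 ac2' parnT.
rewrite /= -y3; case: ifP => yT.
  move=> [q [hq nq C _]]; apply: wpt_if => [_|]; last by rewrite /= T3 yT.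
  have wS3 : wf n (conf st3) by rewrite c3.
  have B3 : best_ok n (rmem st3 rW) (conf st3) (bv st3) (bx st3) by rewrite W3 c3 bv3 bx3.
  have C3 : cycle_ok n (conf st3) (nmem st3 vT 0 0) (nmem st3 vT 0 0 :: q) by rewrite c3 T3.
  have K3' : nmem st3 vK 0 0 = cls (conf st3) (nmem st3 vT 0 0) by rewrite c3 T3 cT2.
  have x3 : rep (conf st3) (nmem st3 vX 0 0) = head (nmem st3 vT 0 0) q.
    rewrite c3 (fr3 vX isT) x2 -parT; move: hq nq; case: (q) => //= y q' /andP[/eqP-> _] _.
    by [].
  apply: wpt_weaken (merge_cycle_spec n3 wS3 B3 C3 K3' x3) _ => t st4 [fr4 frr4] [lt [M B4]].
  rewrite c3 T3 in M; rewrite W3 in B4.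
  have [I4 ac4] := merge_step I2 ac2' C M.
  have [sup4 uns4] := merge_potential wS2 C M.
  have h4 : history st4 = history st2.
    by rewrite -h3 /history /event_at (fr4 aMem isT) (fr4 aEvx isT) (fr4 aEvv isT) (fr4 aE isT).
  have qpos : 0 < size q by case: (q) nq.
  (* The event removes an unselected class and the merge restores at most one, so the supernodes in
     [q] are a net drop. It is positive, as the selected arc joins two supernodes, and pays for the
     merge. *)
  have pot : potential st4 + size q <= potential st by rewrite /potential; lia.
  move=> t3 lt3 t2 lt2 t1 lt1; split; first split=> //.
  - by rewrite (fr4 aN isT).
  - by rewrite (frr4 rW isT).
  - by rewrite h4 h2; exists (L + red W (conf st) (x, v))%R.
  - by rewrite h4 h2 /= vn.
  - by rewrite (fr4 aE isT) e3; lia.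
  - lia.
  - have : size q <= potential st - potential st4 by lia.
    move: lt lt1 lt2 lt3 qpos => /=; move: (potential st - potential st4) (size q) => d s.
    move=> lt lt1 lt2 lt3 s1 sd; have := leq_mul (leqnn n.+1) sd; have := leq_mul (leqnn n.+1) s1; lia.
move=> ac3; apply: wpt_if => [|_]; first by rewrite /= T3 yT.
exists 1, st3; split; first exact: exec_skip.
have pot : potential st3 < potential st by rewrite /potential c3; lia.
move=> t3 lt3 t2 lt2 t1 lt1; split; first split=> //.
- by rewrite h3 h2 c3; exists (L + red W (conf st) (x, v))%R.
- by rewrite c3.
- by rewrite c3 bv3 bx3.
- by rewrite h3 h2 /= vn.
- by rewrite e3; lia.
- exact: pot.
- have : 1 <= potential st - potential st3 by lia.
  move: lt1 lt2 lt3 => /=; move: (potential st - potential st3) => d.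
  move=> lt1 lt2 lt3 d1; have := leq_mul (leqnn n.+1) d1; lia.
Qed.

End Phase.

(** * Main loop and backward pass *)

Section MainLoops.
Variables (R : realType) (n : nat).
Implicit Types st : state R.

Lemma main_inv_find W (S0 : config R) st st' :
  frame find_unselected st st' -> main_inv n W S0 st -> main_inv n W S0 st'.
Proof.
move=> fr M; have c : conf st' = conf st by apply: conf_frame fr _ _.
have [nE WE I ac B hd ev] := M; have [fr1 frr1] := fr.
have h : history st' = history st.
  by rewrite /history /event_at (fr1 aMem isT) (fr1 aEvx isT) (fr1 aEvv isT) (fr1 aE isT).
have b : bv st' = bv st by rewrite /bv (fr1 aBv isT).
have bx' : bx st' = bx st by rewrite /bx (fr1 aBx isT).
by split; rewrite ?(fr1 aN isT) ?(frr1 rW isT) ?(fr1 aE isT) ?h ?b ?bx' /potential ?c.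
Qed.

Lemma contract_spec W S0 st : main_inv n W S0 st ->
  wp contract (5000 * n.+1 ^ 2) (fun st' => main_inv n W S0 st' /\
    forall u, u < n -> sel (conf st') (cls (conf st') u)) st.
Proof.
move=> M; pose I k st' := [/\ main_inv n W S0 st', potential n st' = k &
  if nmem st' vF 0 0 == n then forall u, u < n -> sel (conf st') (cls (conf st') u)
  else nmem st' vF 0 0 < n /\ ~~ sel (conf st') (cls (conf st') (nmem st' vF 0 0))].
have find_I st1 : main_inv n W S0 st1 ->
    wp find_unselected (60 * n.+1) (I (potential n st1)) st1.
  move=> M1; apply: wp_weaken (find_unselected_spec (mi_n M1)) (leqnn _) _ => st2 fr F.
  have c : conf st2 = conf st1 by apply: conf_frame fr _ _.
  by split; rewrite ?/potential ?c //; apply: main_inv_find fr M1.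
apply: (@wp_seq _ _ _ (60 * n.+1) (4900 * n.+1 ^ 2) _ (I (potential n st))); last by nia.
  exact: find_I.
move=> st1 fr1 I1.
have := @wp_while _ (nneq (scal vF) (scal aN)) (phase ;; find_unselected) I (2060 * n.+1) _ st1.
move=> h; apply: wp_weaken (h _ _ I1) _ _.
- move=> k st2 [M2 pk F2]; rewrite /= (mi_n M2) => fn.
  move: F2; rewrite (negbTE fn) => -[flt nsel].
  have [t2 [st3 [e3 [M3 plt lt2]]]] := phase_spec M2 flt nsel.
  have [t3 [st4 [e4 [lt4 I4]]]] := find_I _ M3.
  exists (t2 + t3), st4; split; first exact: exec_seq e3 e4.
  exists (potential n st3); split=> //; rewrite -?pk //.
  have : 1 <= potential n st2 - potential n st3 by lia.
  move: lt2 lt4; move: (_ - _) => d lt2 lt4 d1.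
  have := leq_mul (leqnn n.+1) d1; lia.
- have : potential n st <= 2 * n by apply: leq_trans (mi_events M); apply: leq_addl.
  move: (potential n st) => p /=; nia.
- move=> st2 fr2 [nb [k [M2 pk F2]]]; split=> //.
  by move: F2 nb; rewrite /= (mi_n M2); case: eqP.
Qed.

Lemma expand_events_spec st : nmem st aN 0 0 = n ->
  (forall i, nmem st aChosen i 0 = 0) -> (forall i j, nmem st aOut i j = 0) ->
  all (fun e : event => e.2.2 < n) (history st) ->
  wp expand_events (200 * n.+1 * (nmem st aE 0 0).+1)
    (fun st' => forall i j, i < n -> j < n -> (nmem st' aOut i j != 0) =
       ((i, j) \in expand (history st) [::]) && (nmem st aAdj i j != 0)) st.
Proof.
move=> nE ch0 out0 evn; set E := nmem st aE 0 0.
apply: (@wp_seq_run _ _ _ (150 * n.+1 * E.+1)) => //; last by rewrite /=; nia.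
move=> st1 [fr1 frr1] st1E.
have i1 : nmem st1 vI 0 0 = E by rewrite st1E.
pose b := nlt (NConst 0) (scal vI).
set body := (X in While _ X).
pose hist k := [seq event_at st e | e <- rev (iota 0 k)].
(* Expanding the [k] events still to come from the arcs [F] chosen so far gives the final result.
   The memory holds only the heads of [F] and its arcs that belong to the digraph. *)
pose I k st' := [/\ frame body st st', nmem st' vI 0 0 = k, k <= E &
  exists F : seq (nat * nat), [/\ expand (hist k) F = expand (history st) [::],
    {in F, forall a, a.2 < n},
    forall u, u < n -> (nmem st' aChosen u 0 != 0) = (u \in [seq a.2 | a <- F]) &
    forall i j, i < n -> j < n ->
      (nmem st' aOut i j != 0) = ((i, j) \in F) && (nmem st aAdj i j != 0)]].
have histS k : hist k.+1 = event_at st k :: hist k.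
  by rewrite /hist -addn1 iotaD rev_cat.
have I1 : I E st1.
  have fr : frame body st st1.
    split=> x h; last exact: frr1.
    by apply: fr1; apply: contra h => /=; rewrite inE => /eqP->.
  split=> //; exists [::]; split=> //.
    by move=> u un; rewrite (fr1 aChosen isT) ch0.
  by move=> i j _ _; rewrite (fr1 aOut isT) out0.
have := @wp_while _ b body I (140 * n.+1) E st1 _ I1.
move=> h; apply: wp_weaken (h _) _ _; last 2 first.
- rewrite /=; nia.
- move=> st2 _ [nb [k [_ ik _ [F [h1 _ _ h3]]]]]; move: nb; rewrite /= ik -ltnNge => k0.
  have {}k0 : k = 0 by lia.
  by rewrite k0 in h1; move=> i j ii jj; rewrite -h1 /=; apply: h3.
move=> {h I1 i1 st1E} k st2 [fr2 ik kE [F [h1 hF h2 h3]]] /=; rewrite ik add0n.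
case: k ik kE h1 => // k ik kE h1 _.
suff : wp body (140 * n.+1) (I k) st2.
  move=> [t [st3 [e3 [lt3 I3]]]]; exists t, st3; split=> //.
  by exists k; split=> //; rewrite subSnn muln1.
have {fr2}fr2' := fr2; have [fr2 frr2] := fr2'.
have ev_lt : nmem st aEvv k 0 < n.
  move: evn; rewrite /history all_map => /allP; apply.
  by rewrite mem_rev mem_iota add0n; lia.
rewrite /body.
apply: (@wp_seq_run _ _ _ (130 * n.+1)) => //; last by rewrite /=; lia.
move=> st3 [fr3 frr3] st3E; have i3 : nmem st3 vI 0 0 = k by rewrite st3E /= /update /= ik subn1.
apply: (@wp_seq_run _ _ _ (120 * n.+1)) => //; last by rewrite /=; lia.
move=> st4 [fr4 frr4] st4E; have f4 : nmem st4 vF 0 0 = 0 by rewrite st4E.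
have fr4E := (fr4 aN isT, fr4 aMem isT, fr4 aChosen isT, fr4 aAdj isT, fr4 aEvx isT,
  fr4 aEvv isT, fr4 aOut isT, fr4 vI isT, i3, fr3 aN isT, fr3 aMem isT, fr3 aChosen isT,
  fr3 aAdj isT, fr3 aEvx isT, fr3 aEvv isT, fr3 aOut isT,
  fr2 aN isT, fr2 aMem isT, fr2 aAdj isT, fr2 aEvx isT, fr2 aEvv isT).
pose hit u := (nmem st aMem k u != 0) && (nmem st2 aChosen u 0 != 0).
apply: (@wp_seq _ _ _ (80 * n.+1) 40 _ (fun st' => (nmem st' vF 0 0 != 0) = has hit (iota 0 n)));
  last by lia.
  apply: (@wp_for_frame _ _ _ _ (fun m st' => (nmem st' vF 0 0 != 0) = has hit (iota 0 m)) n 60) => //.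
  - by rewrite /= /update /= f4.
  - by move=> st5 [fr5 _] /=; rewrite (fr5 aN isT) !fr4E.
  - move=> m st5 mn [fr5 frr5] I5 im.
    have fr5E := (fr5 aMem isT, fr5 aChosen isT, fr5 vI isT, fr4E).
    have hasS : has hit (iota 0 m.+1) = has hit (iota 0 m) || hit m.
      by rewrite -addn1 iotaD has_cat /= add0n orbF.
    have cE : beval st5 (BAnd (nneq (NGet aMem (scal vI) (scal vJ)) (NConst 0))
                 (nneq (vec aChosen (scal vJ)) (NConst 0))) = hit m.
      by rewrite /= im !fr5E.
    apply: (@wp_if _ _ _ _ 8) => //; rewrite cE => hh; apply: wp_run => //; rewrite hasS.
      by rewrite hh orbT.
    by rewrite (negbTE hh) orbF -I5.
  - rewrite /=; lia.
move=> st5 fr5' f5; have [fr5 frr5] := fr5'.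
have fr5E := (fr5 aN isT, fr5 aMem isT, fr5 aChosen isT, fr5 aAdj isT, fr5 aEvx isT,
  fr5 aEvv isT, fr5 aOut isT, fr5 vI isT, fr4E).
have frame5 st6 : (forall x, x \notin modn body -> nmem st6 x = nmem st5 x) ->
    (forall x, x \notin modr body -> rmem st6 x = rmem st5 x) -> frame body st st6.
  move=> g1 g2; apply: frame_trans fr2' _; split=> x hx; rewrite ?g1 ?g2 //.
    move: hx; rewrite /body /= !inE !negb_or => /andP[x1 /andP[x2 /andP[x3 /andP[x4 /andP[x5 _]]]]].
    rewrite fr5 ?fr4 ?fr3 //= ?inE ?negb_or ?x1 ?x2 ?x3 ?x4 ?x5 //.
  by rewrite frr5 ?frr4 ?frr3.
have hasE : has hit (iota 0 n) = has (fun a => nmem st aMem k a.2 != 0) F.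
  apply/hasP/hasP => [[u]|[a aF ma]].
    rewrite mem_iota add0n => /andP[_ un] /andP[mu]; rewrite h2 // => /mapP[a aF e].
    by exists a; rewrite -?e.
  exists a.2; first by rewrite mem_iota add0n hF.
  by rewrite /hit ma h2 ?hF // map_f.
have i5 : nmem st5 vI 0 0 = k by rewrite !fr5E.
apply: (@wp_if _ _ _ _ 30) => // cE; last first.
  apply: wp_run => //; split=> //; first exact: frame5.
    by lia.
  exists F; split=> //.
  - by rewrite -h1 histS /= -hasE -f5 (cE : nmem st5 vF 0 0 != 0).
  - by move=> u un; rewrite !fr5E h2.
  - by move=> i j ii jj; rewrite !fr5E h3.
apply: wp_run => //=; split=> /=; rewrite ?i5 //; last 1 first.
  exists ((nmem st aEvx k 0, nmem st aEvv k 0) :: F); split.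
  - by rewrite -h1 histS /= -hasE -f5 (eqP cE : nmem st5 vF 0 0 = 0).
  - by move=> a; rewrite inE => /predU1P[->//|/hF].
  - move=> u un /=; rewrite /update /= !fr5E inE -h2 //=.
    by case: (u == _).
  - move=> i j ii jj /=; rewrite /update /= !fr5E inE xpair_eqE.
    have [/andP[/eqP-> /eqP->]|_] := boolP ((i == _) && (j == _)); first by [].
    by rewrite ?fr5E h3.
- apply: frame5 => // x; rewrite /body /= !inE !negb_or.
  move=> /and4P[_ _ _ /and4P[_ _ x14 x3]] /=.
  by rewrite /update (negbTE x14) (negbTE x3).
- lia.
Qed.

End MainLoops.

(** * Weights and tables before the first selection *)

Section Initialization.
Variables (R : realType) (n : nat).
Implicit Types st : state R.

Local Notation redS st := (red (rmem st rW) (conf st)).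

Definition big_weight (w : nat -> nat -> R) : R :=
  (1 + \sum_(i < n) \sum_(j < n) (1 + w i j * w i j))%R.

Lemma init_bound_spec st : nmem st aN 0 0 = n ->
  wp init_bound (200 * n.+1 ^ 2)
    (fun st' => rmem st' rM 0 0 = big_weight (rmem st rW)) st.
Proof.
move=> nE; set w := rmem st rW.
apply: (@wp_seq_run _ _ _ (190 * n.+1 ^ 2)) => //; last by rewrite /=; nia.
move=> st1 [fr1 frr1] st1E; have F1 : rmem st1 rM 0 0 = 1%R by rewrite st1E.
apply: (@wp_for_frame _ _ _ _ (fun k st' => rmem st' rM 0 0 =
  (1 + \sum_(i < k) \sum_(j < n) (1 + w i j * w i j))%R) n (100 * n.+1)) => //.
- by rewrite /= F1 big_ord0 addr0.
- by move=> st2 [fr2 _] /=; rewrite (fr2 aN isT) (fr1 aN isT).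
- move=> k st2 kn [fr2 frr2] I2 ik.
  apply: wp_weaken (_ : wp _ (100 * n.+1) (fun st' => rmem st' rM 0 0 =
    (rmem st2 rM 0 0 + \sum_(j < n) (1 + w k j * w k j))%R) _) (leqnn _) _; last first.
    by move=> st3 _ I3; rewrite /= I3 I2 big_ord_recr /= addrA.
  apply: (@wp_for_frame _ _ _ _ (fun m st' => rmem st' rM 0 0 =
    (rmem st2 rM 0 0 + \sum_(j < m) (1 + w k j * w k j))%R) n 60) => //.
  + by rewrite /= big_ord0 addr0.
  + by move=> st3 [fr3 _] /=; rewrite (fr3 aN isT) (fr2 aN isT) (fr1 aN isT).
  + move=> m st3 mn [fr3 frr3] I3 im; apply: wp_run => //=.
    rewrite /update /= I3 big_ord_recr /= addrA (fr3 vI isT) ik im.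
    by rewrite (frr3 rW isT) (frr2 rW isT) (frr1 rW isT) !addrA. 
  + rewrite /=; lia.
- rewrite /=; nia.
Qed.

Definition full_weight (w : nat -> nat -> R) (adj : nat -> nat -> nat) (M : R) i j : R :=
  (if adj i j == 0%N then M + M else w i j + M)%R.

Lemma init_weights_spec st : nmem st aN 0 0 = n ->
  wp init_weights (200 * n.+1 ^ 2)
    (fun st' => [/\ forall i j, i <= n -> j < n -> rmem st' rW i j =
        full_weight (rmem st rW) (nmem st aAdj) (rmem st rM 0 0) i j,
      forall i, i <= n -> nmem st' aRep i 0 = i
    & forall i j, i <= n -> j < n -> bv st' i j = j]) st.
Proof.
move=> nE; pose W := full_weight (rmem st rW) (nmem st aAdj) (rmem st rM 0 0).
pose I k st' := [/\ forall i j, rmem st' rW i j =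
      if (i < k) && (j < n) then W i j else rmem st rW i j,
    forall i, i < k -> nmem st' aRep i 0 = i
  & forall i j, i < k -> j < n -> bv st' i j = j].
apply: (@wp_weaken _ _ (200 * n.+1 ^ 2) _ (I n.+1)) => //; last first.
  move=> st1 _ [I1 I2 I3]; split=> [i j i1 j1|i i1|i j i1 j1].
  - by rewrite I1 ltnS i1 j1.
  - by apply: I2.
  - by apply: I3.
apply: (@wp_for_frame _ _ _ _ I n.+1 (130 * n.+1)) => //.
- by move=> st1 [fr1 _] /=; rewrite (fr1 aN isT) nE addn1.
- move=> k st1 kn [fr1 frr1] [I1 I2 I3] ik.
  have lt_k u : (u < k.+1) = (u == k) || (u < k) by rewrite ltnS leq_eqVlt.
  apply: (@wp_seq_run _ _ _ (120 * n.+1)) => //; last by rewrite /=; lia.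
  move=> st2 [fr2 frr2] st2E.
  have rep2 i : nmem st2 aRep i 0 = if i == k then k else nmem st1 aRep i 0.
    by rewrite st2E /= /update /= ik andbT.
  pose J m st' := (forall i j, rmem st' rW i j =
      if ((i < k) && (j < n)) || ((i == k) && (j < m)) then W i j else rmem st rW i j) /\
    (forall i j, (i < k) && (j < n) || ((i == k) && (j < m)) -> bv st' i j = j).
  apply: (@wp_weaken _ _ (120 * n.+1) _ (J n)) => //; last first.
    move=> st3 [fr3 frr3] [J1 J2]; split=> [i j|i|i j] /=.
    - by rewrite J1 lt_k -andb_orl [(i < k) || _]orbC.
    - rewrite lt_k /update /= (fr3 aRep isT) rep2; case: eqP => [-> //|_ /= h].
      exact: I2.
    - by rewrite lt_k /bv /update /= => h jn; apply: J2; rewrite jn !andbT orbC.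
  apply: (@wp_for_frame _ _ _ _ J n 90) => //.
  + split=> [i j|i j]; rewrite ltn0 andbF orbF; first by rewrite /= (frr2 rW isT) I1.
    by move=> /andP[ik' jn]; rewrite /bv /= /update /= (fr2 aBv isT) -/(bv st1 i j) I3.
  + by move=> st3 [fr3 _] /=; rewrite (fr3 aN isT) (fr2 aN isT) (fr1 aN isT).
  + move=> m st3 mn [fr3 frr3] [J1 J2] im.
    have lt_m u : (u < m.+1) = (u == m) || (u < m) by rewrite ltnS leq_eqVlt.
    have fr3E := (fr3 vI isT, fr3 aAdj isT, frr3 rM isT, fr2 vI isT, fr2 aAdj isT, frr2 rM isT,
      fr1 aAdj isT, frr1 rM isT, ik, im).
    have Wkm : rmem st3 rW k m = rmem st rW k m by rewrite J1 !ltnn !andbF.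
    apply: (@wp_seq _ _ _ 60 10 _ (fun st' => forall i j, rmem st' rW i j =
        if (i == k) && (j == m) then W k m else rmem st3 rW i j)); last by [].
      apply: (@wp_if _ _ _ _ 30) => // /= cE; apply: wp_run => //= i j;
        rewrite /update /= !fr3E ?Wkm; case: ifP => // _;
        by move: cE; rewrite !fr3E /W /full_weight => cE; rewrite ?cE ?(negbTE cE).
    move=> st4 [fr4 frr4] K4; apply: wp_run => //; split=> [i j|i j].
      rewrite /= K4 J1 lt_m; case: (eqVneq i k) => [->|_] //=; rewrite ltnn //=.
      by case: (eqVneq j m) => [->|_].
    rewrite /bv /= /update /= !(fr4 vI isT, fr4 vJ isT, fr3E) (fr4 aBv isT) -/(bv st3 i j).
    case: (eqVneq i k) => [->|ik'] /=; case: (eqVneq j m) => [->|jm] //=.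
    * by rewrite ltnn /= lt_m (negbTE jm) /= => h; apply: J2; rewrite eqxx h orbT.
    * by rewrite orbF => h; apply: J2; rewrite h.
    * by rewrite orbF => h; apply: J2; rewrite h.
  + rewrite /=; lia.
- rewrite /=; nia.
Qed.

Lemma init_best_spec st : nmem st aN 0 0 = n ->
  (forall i, i <= n -> nmem st aRep i 0 = i) ->
  (forall i j, i <= n -> j < n -> bv st i j = j) ->
  wp init_best (300 * n.+1 ^ 2)
    (fun st' => best_ok n (rmem st' rW) (conf st') (bv st') (bx st')) st.
Proof.
move=> nE repE bvE.
pose I k st' := forall t, t < k -> [/\ bx st' t <= n, bx st' t != t &
  forall x, x <= n -> x != t -> (redS st (bx st' t, t) <= redS st (x, t))%R].
apply: (@wp_weaken _ _ (300 * n.+1 ^ 2) _ (I n)) => //; last first.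
  move=> st1 [fr1 frr1] I1.
  have bv1 : bv st1 = bv st by rewrite /bv (fr1 aBv isT).
  have rep1 i : i <= n -> rep (conf st1) i = i by move=> h; rewrite /= (fr1 aRep isT) repE.
  have red1 : redS st1 =1 redS st by move=> a; rewrite /red /= (frr1 rW isT) (frr1 rOff isT).
  split=> [x t xn tn rt|t tn rt].
    rewrite bv1 bvE //; split=> //.
    by move=> v vn; rewrite rep1 1?ltnW // => ->.
  have [h1 h2 h3] := I1 t tn; split=> //; first by rewrite rep1.
  by move=> x xn; rewrite rep1 // => xt; rewrite !red1 bv1 !bvE //; apply: h3.
apply: (@wp_for_frame _ _ _ _ I n (150 * n.+1)) => //.
- by move=> st1 [fr1 _] /=; rewrite (fr1 aN isT).
- move=> k st1 kn [fr1 frr1] I1 ik.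
  have n1 : nmem st1 aN 0 0 = n by rewrite (fr1 aN isT).
  have rep1 i : i <= n -> rep (conf st1) i = i by move=> h; rewrite /= (fr1 aRep isT) repE.
  have nk : rep (conf st1) n != k by rewrite rep1 // neq_ltn kn orbT.
  have bv1 : bv st1 = bv st by rewrite /bv (fr1 aBv isT).
  have red1 : redS st1 =1 redS st by move=> a; rewrite /red /= (frr1 rW isT) (frr1 rOff isT).
  apply: wp_weaken (compute_best_spec n1 ik nk) (leqnn _) _.
  move=> st2 [fr2 frr2] [b [b1 b2 b3 b4]] t; rewrite ltnS leq_eqVlt /bx /= /update /= -/(bx st2 t) b4.
  case: eqP => [-> _|_ /= tk]; last exact: I1.
  split=> //; first by rewrite rep1 in b2.
  by move=> x xn xk; have := b3 x xn; rewrite rep1 // !red1 bv1 !bvE //; apply.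
- rewrite /=; nia.
Qed.

End Initialization.

(** * Correctness of the program on numbered nodes *)

Section Correctness.
Variables (R : realType) (n : nat).
Implicit Types st : state R.

Definition full_sol (color : nat -> nat) (F : seq (nat * nat)) : Prop :=
  exists r : nat -> nat,
  [/\ forall a, a \in F -> is_arc n a /\ r a.1 < r a.2,
      uniq [seq color a.2 | a <- F]
    & forall u, u < n -> color u \in [seq color a.2 | a <- F]].

Lemma partial_sol_init (S0 : config R) F : init_config n S0 ->
  partial_sol n S0 F <-> full_sol (cls S0) F.
Proof.
move=> [repE selE]; split=> [[r [_ h1 h2 h3]]|[r [h1 h2 h3]]]; exists r; split=> //.
- by move=> u un; have := h3 u un; rewrite (negbTE (selE _)).
- by move=> u v un vn; rewrite !repE // => ->.
- by move=> u un; rewrite (negbTE (selE _)) h3.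
Qed.

Lemma program_spec st : nmem st aN 0 0 = n ->
  (forall x i j, 2 < x -> nmem st x i j = 0) ->
  (forall x i j, 0 < x -> rmem st x i j = 0%R) ->
  let W := full_weight (rmem st rW) (nmem st aAdj) (big_weight n (rmem st rW)) in
  (forall i j, i <= n -> j < n -> (0 <= W i j)%R) ->
  wp branching_program (80 * 100 * n.+1 ^ 2)
    (fun st' => exists F, [/\ full_sol (fun u => nmem st aCls u 0) F,
       forall F', full_sol (fun u => nmem st aCls u 0) F' -> (cost W F <= cost W F')%R
     & forall i j, i < n -> j < n ->
         (nmem st' aOut i j != 0) = ((i, j) \in F) && (nmem st aAdj i j != 0)]) st.
Proof.
move=> nE n0 r0 W W0.
apply: (@wp_seq _ _ _ (200 * n.+1 ^ 2) (78 * 100 * n.+1 ^ 2) _ _ _ _ (init_bound_spec nE)); last by nia.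
move=> st1 fr1' M1; have [fr1 frr1] := fr1'.
have n1 : nmem st1 aN 0 0 = n by rewrite (fr1 aN isT).
apply: (@wp_seq _ _ _ (200 * n.+1 ^ 2) (76 * 100 * n.+1 ^ 2) _ _ _ _ (init_weights_spec n1)); last by nia.
move=> st2 fr2' [W2 rep2 bv2]; have [fr2 frr2] := fr2'.
rewrite M1 (frr1 rW isT) (fr1 aAdj isT) -/W in W2.
have n2 : nmem st2 aN 0 0 = n by rewrite (fr2 aN isT).
apply: (@wp_seq _ _ _ (300 * n.+1 ^ 2) (73 * 100 * n.+1 ^ 2) _ _ _ _ (init_best_spec n2 rep2 bv2)); last by nia.
move=> st3 fr3' B3; have [fr3 frr3] := fr3'.
pose S0 := conf st3; pose W' := rmem st3 rW.
have W'E a : is_arc n a -> W' a.1 a.2 = W a.1 a.2.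
  by move=> /andP[a1 a2]; rewrite /W' (frr3 rW isT) W2.
have costE F : (forall a, a \in F -> is_arc n a) -> cost W' F = cost W F.
  by move=> hF; apply: eq_big_seq => a /hF /W'E.
have fr_zero x i j : 2 < x -> x \notin modn (init_bound;; init_weights;; init_best) ->
    nmem st3 x i j = 0.
  by move=> x2 hx; rewrite (proj1 (frame_seq fr1' (frame_seq fr2' fr3'))) // n0.
have I0 : init_config n S0.
  split=> [u un|k]; first by rewrite /S0 /= (fr3 aRep isT) rep2.
  by rewrite /S0 /= fr_zero.
have clsE : cls S0 = (fun u => nmem st aCls u 0).
  by rewrite /S0 /= (fr3 aCls isT) (fr2 aCls isT) (fr1 aCls isT).
have hist3 : history st3 = [::] by rewrite /history (fr_zero aE).
have M : main_inv n W' S0 st3.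
  split=> //; rewrite ?hist3 //.
  - by rewrite (fr3 aN isT).
  - exists 0%R; apply: inv_init => // [u un|a aa].
      by rewrite /S0 /= (frr3 rOff isT) (frr2 rOff isT) (frr1 rOff isT) r0.
    by rewrite W'E //; case/andP: aa => *; apply: W0.
  - exists (fun=> 0) => // u un; by rewrite /= fr_zero.
  - by rewrite fr_zero // add0n potential_le.
apply: (@wp_seq _ _ _ (5000 * n.+1 ^ 2) (2300 * n.+1 ^ 2) _ _ _ _ (contract_spec M)); last by nia.
move=> st4 fr4' [[n4 W4 [L I4] ac4 B4 hd4 ev4] all_sel]; have [fr4 frr4] := fr4'.
have [sol4 opt4] := optimal_expand I4 ac4 all_sel.
have fr_zero4 x i j : 2 < x -> x \notin modn (init_bound;; init_weights;; init_best;; contract) ->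
    nmem st4 x i j = 0.
  move=> x2 hx.
  by rewrite (proj1 (frame_seq fr1' (frame_seq fr2' (frame_seq fr3' fr4')))) // n0.
apply: wp_weaken (expand_events_spec n4 _ _ hd4) _ _ => //.
- by move=> i; apply: fr_zero4.
- by move=> i j; apply: fr_zero4.
- have : nmem st4 aE 0 0 <= 2 * n by apply: leq_trans ev4; apply: leq_addr.
  move: (nmem st4 aE 0 0) => e; nia.
move=> st5 _ out5; exists (expand (history st4) [::]).
have solE F : partial_sol n S0 F <-> full_sol (fun u => nmem st aCls u 0) F.
  by rewrite -clsE; apply: partial_sol_init.
have arcs F : partial_sol n S0 F -> forall a, a \in F -> is_arc n a.
  by move=> [r [_ h _ _]] a /h[].
split; first by apply/solE.
- move=> F' /solE hF'; rewrite -!costE; try exact: arcs.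
  exact: opt4.
- move=> i j ii jj; rewrite out5 // (fr4 aAdj isT) (fr3 aAdj isT) (fr2 aAdj isT) (fr1 aAdj isT).
  by [].
Qed.

End Correctness.

(** * From digraphs to numbered nodes *)

Lemma seq_argmax (A : eqType) (f : A -> nat) (s : seq A) : s != [::] ->
  exists2 x, x \in s & forall y, y \in s -> f y <= f x.
Proof.
elim: s => // x s IH _; have [->|/IH[z zs mz]] := eqVneq s [::].
  by exists x; rewrite ?mem_head // => y; rewrite inE => /eqP->.
have [xz|zx] := leqP (f x) (f z).
  by exists z; rewrite ?inE ?zs ?orbT // => y; rewrite inE => /predU1P[->|/mz].
exists x; rewrite ?mem_head // => y; rewrite inE => /predU1P[->//|/mz h].
exact: leq_trans h (ltnW zx).
Qed.

Lemma map_uniq_inj (A B : eqType) (f : A -> B) (s : seq A) (x y : A) :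
  uniq (map f s) -> x \in s -> y \in s -> f x = f y -> x = y.
Proof.
elim: s => //= z s IH /andP[fz us]; rewrite !inE.
move=> /predU1P[->|xs] /predU1P[->|ys] // e; last exact: IH.
  by case/mapP: fz; exists y.
by case/mapP: fz; exists x.
Qed.

(** * Undirected acyclicity and ranks *)

Section Branchings.
Variable V : finType.
Implicit Types B : {set V * V}.

(** The rank counts ancestors. The head of an arc has all ancestors of the tail and itself; if it
    were already an ancestor of the tail, a simple path back would give a directed cycle, which is
    an undirected one. *)
Lemma acyclic_rank B : undirected_acyclic B ->
  exists r : V -> nat, forall a, a \in B -> r a.1 < r a.2.
Proof.
move=> acB; pose e := [rel u v | (u, v) \in B].
exists (fun v => #|[pred u | connect e u v]|) => -[x v] /= xvB.
apply/proper_card/properP; split.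
  by apply/subsetP => u; rewrite !inE => ux; apply: connect_trans ux (connect1 _).
exists v; rewrite inE ?connect0 //; apply/negP => /connectP[p0 /shortenP[p ep up _] ex].
pose q := v :: p; have cq : cycle e q by rewrite /= rcons_path ep -ex.
have := acB [seq ((z, next q z), z) | z <- q]; apply/negP; rewrite negbK.
apply/and5P; split=> //.
- by rewrite /unzip1 -map_comp map_inj_uniq // => y z [].
- by rewrite /unzip2 -map_comp map_id.
- by apply/allP => _ /mapP[_ /mapP[z zq ->] ->]; apply: (next_cycle cq zq).
- rewrite cycle_map; apply: sub_cycle (cycle_next up) => y z /= /eqP <-.
  by rewrite /joins eqxx.
Qed.

Lemma head_inj B (a b : V * V) : (forall v, #|[set a in B | a.2 == v]| <= 1) ->
  a \in B -> b \in B -> a.2 = b.2 -> a = b.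
Proof.
move=> hB aB bB e; apply: (card_le1_eqP (hB b.2)); rewrite inE ?aB ?bB ?e eqxx //.
Qed.

(* Around a node of maximal rank, both edges of a cycle would enter it. *)
Lemma rank_acyclic B (r : V -> nat) : (forall v, #|[set a in B | a.2 == v]| <= 1) ->
  (forall a, a \in B -> r a.1 < r a.2) -> undirected_acyclic B.
Proof.
move=> hB hr [//|p0 c0]; set c := p0 :: c0.
apply/negP => /and5P[_ u1 u2 /allP cB cc].
have uc : uniq c by apply: map_uniq u1.
have cB' p : p \in c -> p.1 \in B by move=> pc; apply: cB; apply: map_f.
have [p pc pmax] : exists2 p, p \in c & forall p', p' \in c -> r p'.2 <= r p.2.
  exact: (seq_argmax (fun p => r p.2)).
have tip a u : a \in B -> joins a p.2 u || joins a u p.2 -> r u <= r p.2 -> a.2 = p.2.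
  move=> aB ja ru; have := hr a aB; case: a ja {aB} => x y /=; rewrite /joins /=.
  rewrite !xpair_eqE => /orP[] /orP[] /andP[/eqP-> /eqP->] //; by rewrite ltnNge ru.
have jn := next_cycle cc pc; have jp := prev_cycle cc pc.
have h1 : p.1.2 = p.2.
  by apply: (tip _ (next c p).2); rewrite ?cB' ?jn // pmax // mem_next.
have h2 : (prev c p).1.2 = p.2.
  by apply: (tip _ (prev c p).2); rewrite ?cB' ?mem_prev ?jp ?orbT // pmax // mem_prev.
(* Both edges at [p.2] enter it, so they are one arc. As the arcs of a cycle are distinct, the cycle
   is a loop, which a strict rank excludes. *)
have e1 : (prev c p).1 = p.1.
  by apply: (head_inj hB); rewrite ?cB' ?mem_prev // h1 h2.
have eP : prev c p = p by apply: (map_uniq_inj u1) => //; rewrite mem_prev.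
have := hr _ (cB' p pc); move: jp; rewrite eP /joins.
by case: p.1 => x y; rewrite !xpair_eqE => /orP[] /andP[/eqP-> /eqP->] /=; rewrite ltnn.
Qed.

End Branchings.

(** * Matroid branchings as sets with one arc per color *)

Section Translation.
Variables (R : realType) (G : digraph) (w : node G * node G -> R) (color : node G -> nat).

Let n := #|node G|.
Let en (v : node G) : nat := enum_rank v.
Let adj i j : nat := nmem (input w color) 1 i j.
Let col i : nat := nmem (input w color) 2 i 0.
Let wn i j : R := rmem (input w color) 0 i j.

Lemma en_lt v : en v < n. Proof. exact: ltn_ord. Qed.

Lemma en_inj : injective en. Proof. by move=> u v /val_inj/enum_rank_inj. Qed.

Lemma en_onto i : i < n -> exists v, en v = i.
Proof. by move=> h; exists (enum_val (Ordinal h)); rewrite /en enum_valK. Qed.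

Lemma node_at_en v : node_at G (en v) = Some v.
Proof.
rewrite /node_at; case: pickP => [u /eqP/en_inj->//|/(_ v)].
by rewrite /en eqxx.
Qed.

Lemma node_at_n : node_at G n = None.
Proof. by rewrite /node_at; case: pickP => // u; rewrite ltn_eqF // ltn_ord. Qed.

Lemma arc_at_en u v : arc_at G (en u) (en v) = if (u, v) \in arcs G then Some (u, v) else None.
Proof. by rewrite /arc_at !node_at_en. Qed.

Lemma adj_en u v : (adj (en u) (en v) != 0) = ((u, v) \in arcs G).
Proof. by rewrite /adj /= arc_at_en; case: ifP. Qed.

Lemma adj_n j : adj n j = 0.
Proof. by rewrite /adj /= /arc_at node_at_n. Qed.

Lemma col_en v : col (en v) = color v.
Proof. by rewrite /col /= node_at_en. Qed.

Lemma wn_en u v : (u, v) \in arcs G -> wn (en u) (en v) = w (u, v).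
Proof. by move=> h; rewrite /wn /= arc_at_en h. Qed.

Let M := big_weight n wn.
Let W := full_weight wn adj M.

Lemma big_weight_gt : (2 * \sum_(a in arcs G) `|w a| < M)%R.
Proof.
rewrite /M /big_weight.
have -> : (\sum_(i < n) \sum_(j < n) (1 + wn i j * wn i j) =
    \sum_(a : node G * node G) (1 + wn (en a.1) (en a.2) * wn (en a.1) (en a.2)))%R.
  rewrite (reindex (@enum_rank (node G))); last exact: onW_bij (@enum_rank_bij _).
  rewrite (eq_bigr (fun u : node G => \sum_(v : node G) (1 + wn (en u) (en v) * wn (en u) (en v)))%R).
    by rewrite pair_big.
  by move=> u _; rewrite (reindex (@enum_rank (node G))) //; apply: onW_bij (@enum_rank_bij _).
rewrite mulr_sumr big_mkcond /=.
suff: (\sum_(a : node G * node G) (if a \in arcs G then 2 * `|w a| else 0) <=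
    \sum_(a : node G * node G) (1 + wn (en a.1) (en a.2) * wn (en a.1) (en a.2)))%R by lra.
apply: ler_sum => -[u v] _ /=; case: ifP => h; last by nra.
rewrite wn_en //; have := sqr_ge0 (w (u, v) - 1); have := sqr_ge0 (w (u, v) + 1).
by case: (ler0P (w (u, v))) => _; nra.
Qed.

(** Each weight is at most [sum |w|] in absolute value. This is why one more arc, worth [M],
    outweighs any loss of weight. *)
Lemma weight_diff (B B' : {set node G * node G}) :
  B \subset arcs G -> B' \subset arcs G -> (weight w B - weight w B' < M)%R.
Proof.
have bnd (X : {set node G * node G}) : X \subset arcs G ->
    (`|weight w X| <= \sum_(a in arcs G) `|w a|)%R.
  move=> XG; apply: le_trans (ler_norm_sum _ _ _) _.
  rewrite big_mkcond [leRHS]big_mkcond /=; apply: ler_sum => a _.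
  by case: ifP => [/(subsetP XG)->//|_]; case: ifP.
move=> /bnd + /bnd; rewrite !ler_norml => /andP[_ h1] /andP[h2 _].
have := big_weight_gt; lra.
Qed.

Lemma full_weight_ge0 i j : i <= n -> j < n -> (0 <= W i j)%R.
Proof.
have M0 : (0 <= M)%R.
  apply: le_trans (ltW big_weight_gt); apply: mulr_ge0 => //; exact: sumr_ge0.
move=> iln /en_onto[v <-]; rewrite /W /full_weight; case: eqP => [_|/eqP h]; first by lra.
move: iln h; rewrite leq_eqVlt => /predU1P[->|/en_onto[u <-]]; first by rewrite adj_n.
rewrite adj_en => h; rewrite wn_en //.
have := big_weight_gt; rewrite (big_rem (u, v)) ?mem_index_enum //= h.
set X := (\sum_(y <- rem _ _ | _) _)%R; have X0 : (0 <= X)%R by apply: sumr_ge0.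
have := ler_norm (- w (u, v)); have := normr_ge0 (w (u, v)); rewrite normrN.
move: X M X0 M0 => X M' X0 M0; lra.
Qed.

(* The arcs of [F] other than those leaving the source and those added to
   complete the digraph. *)
Definition real_arcs (F : seq (nat * nat)) : {set node G * node G} :=
  [set a in arcs G | (en a.1, en a.2) \in F].

(** Every arc is charged [M + M], and a real arc is corrected by [w - M]. As [size F] is the number
    of colors, only the first two terms depend on the solution. *)
Lemma cost_full F : full_sol n col F ->
  (cost W F = weight w (real_arcs F) - #|real_arcs F|%:R * M + (size F)%:R * (M + M))%R.
Proof.
move=> [r [hF uF _]].
have uF' : uniq F by apply: map_uniq uF.
have realP i j : i <= n -> adj i j != 0 -> j < n -> exists u v,
    [/\ i = en u, j = en v & (u, v) \in arcs G].
  rewrite leq_eqVlt => /predU1P[->|/en_onto[u <-]]; first by rewrite adj_n.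
  by move=> h /en_onto[v ev]; exists u, v; move: h; rewrite -ev adj_en.
have -> : (cost W F = \sum_(a <- F | adj a.1 a.2 != 0%N) (wn a.1 a.2 - M) +
    (size F)%:R * (M + M))%R.
  rewrite [RHS](_ : _ = \sum_(a <- F) ((if adj a.1 a.2 != 0%N then wn a.1 a.2 - M else 0) + (M + M)))%R.
    by apply: eq_bigr => a _; rewrite /W /full_weight; case: eqP => _ /=; lra.
  rewrite big_mkcond big_split /=; congr (_ + _)%R.
  by rewrite big_tnth sumr_const card_ord mulr_natl.
congr (_ + _)%R.
rewrite -big_filter (perm_big [seq (en a.1, en a.2) | a <- enum (real_arcs F)]) /=; last first.
  apply: uniq_perm; first exact: filter_uniq.
    rewrite map_inj_uniq ?enum_uniq // => -[u v] [u' v'] [/val_inj/enum_rank_inj-> /val_inj/enum_rank_inj->].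
    by [].
  move=> [i j]; rewrite mem_filter /=; apply/andP/mapP => [[h ijF]|[[u v]]].
    have [/andP[/= i1 j1] _] := hF _ ijF; have [u [v [ei ej uv]]] := realP i j i1 h j1.
    by exists (u, v); rewrite ?mem_enum ?inE /= ?uv -?ei -?ej.
  by rewrite mem_enum inE /= => /andP[uv uvF] [-> ->]; rewrite adj_en uv.
rewrite big_map big_enum /= (eq_bigr (fun a => w a - M)%R).
  by rewrite sumrB sumr_const mulr_natl.
by move=> [u v]; rewrite inE /= => /andP[uv _]; rewrite wn_en.
Qed.

Lemma size_full F F' : full_sol n col F -> full_sol n col F' -> size F = size F'.
Proof.
move=> [r [h1 h2 h3]] [r' [h1' h2' h3']].
rewrite -(size_map (fun a => col a.2) F) -(size_map (fun a => col a.2) F').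
apply: perm_size; apply: uniq_perm => // k; apply/idP/idP => /mapP[a aF ->].
  by have [/andP[_ an] _] := h1 a aF; apply: h3'.
by have [/andP[_ an] _] := h1' a aF; apply: h3.
Qed.

(** Heads in [F] have pairwise distinct colors, which yields both the bound on entering arcs and
    rainbow independence; the rank yields acyclicity. *)
Lemma real_arcs_branching F : full_sol n col F ->
  matroid_branching (arcs G) color (real_arcs F).
Proof.
move=> [r [hF uF _]].
have inj a b : a \in real_arcs F -> b \in real_arcs F -> color a.2 = color b.2 -> a = b.
  rewrite !inE => /andP[_ aF] /andP[_ bF] e.
  have /= := map_uniq_inj uF aF bF; rewrite !col_en => /(_ e).
  by case: a b {aF bF e} => u v [u' v'] /= [/val_inj/enum_rank_inj-> /val_inj/enum_rank_inj->].
have indeg v : #|[set a in real_arcs F | a.2 == v]| <= 1.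
  apply/card_le1_eqP => a b; rewrite !inE => /andP[ha /eqP ea] /andP[hb /eqP eb].
  by apply: inj; rewrite ?inE // ea eb.
split; first split=> //.
- by apply/subsetP => a; rewrite inE => /andP[].
- apply: (rank_acyclic (r := fun v => r (en v)) indeg) => a; rewrite inE => /andP[_ /hF[_]].
  by [].
- move=> k; apply/card_le1_eqP => u v; rewrite !inE.
  move=> /andP[/imsetP[a aB ->] /eqP ea] /andP[/imsetP[b bB ->] /eqP eb].
  by rewrite (inj a b aB bB) // ea eb.
Qed.

(** Each color that [B] does not cover gets an arc from the source to the first node of that color.
    The source has rank 0 and all nodes are shifted up by one; the added arcs are not in the
    digraph, so [real_arcs] gives back [B]. *)
Lemma branching_full_sol B : matroid_branching (arcs G) color B ->
  exists2 F, full_sol n col F & real_arcs F = B.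
Proof.
move=> [[BG acB indeg] rain]; have [r hr] := acyclic_rank acB.
have inj a b : a \in B -> b \in B -> color a.2 = color b.2 -> a = b.
  move=> aB bB e; apply: (head_inj indeg) => //.
  by apply: (card_le1_eqP (rain (color b.2))); rewrite inE ?e eqxx andbT; apply: imset_f.
pose cols := [seq color a.2 | a <- enum B].
pose fst_col u := find (fun v => col v == col u) (iota 0 n) == u.
pose U := [seq u <- iota 0 n | (col u \notin cols) && fst_col u].
pose F := [seq (en a.1, en a.2) | a <- enum B] ++ [seq (n, u) | u <- U].
have FP p : p \in F -> (exists2 a, a \in B & p = (en a.1, en a.2)) \/
    (exists2 u, u < n /\ col u \notin cols & p = (n, u)).
  rewrite mem_cat => /orP[] /mapP[a aF ->]; [left|right]; exists a => //.
    by rewrite mem_enum in aF.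
  by move: aF; rewrite mem_filter mem_iota add0n => /andP[/andP[nc _] /andP[_ an]].
have colsE : [seq col a.2 | a <- F] = cols ++ map col U.
  rewrite map_cat -!map_comp; congr (_ ++ _); apply: eq_map => a //.
  by rewrite [LHS]col_en.
exists F.
  exists (fun i => if node_at G i is Some v then (r v).+1 else 0); split.
  - move=> _ /FP[[a aB ->]|[u [un _] ->]]; rewrite /is_arc /=.
      by rewrite !node_at_en ltnS hr // en_lt (ltnW (en_lt _)).
    by rewrite node_at_n leqnn un; have [v <-] := en_onto un; rewrite node_at_en.
  - rewrite colsE cat_uniq; apply/and3P; split.
    + rewrite map_inj_in_uniq ?enum_uniq // => a b; rewrite !mem_enum; exact: inj.
    + apply/hasPn => _ /mapP[u uU ->]; move: uU; rewrite mem_filter.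
      by case/andP=> /andP[].
    + rewrite map_inj_in_uniq ?filter_uniq ?iota_uniq // => u v.
      rewrite !mem_filter => /andP[/andP[_ /eqP fu] _] /andP[/andP[_ /eqP fv] _] e.
      by rewrite -fu -fv e.
  - move=> u un; rewrite colsE mem_cat; have [//|nc] := boolP (col u \in cols).
    have hu : has (fun v => col v == col u) (iota 0 n).
      by apply/hasP; exists u; rewrite ?mem_iota.
    pose u' := find (fun v => col v == col u) (iota 0 n).
    have u'n : u' < n by rewrite -[X in _ < X](size_iota 0) -has_find.
    have eu' : col u' = col u.
      by have := nth_find 0 hu; rewrite -/u' nth_iota // add0n => /eqP.
    apply/mapP; exists u'; last exact: esym; rewrite mem_filter mem_iota add0n u'n andbT eu' nc /=.
    by rewrite /fst_col eu' eqxx.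
apply/setP => -[u v]; rewrite inE /=; apply/andP/idP => [[_ /FP[[[u' v'] aB]|[k _]]]|uvB].
- by move=> [/val_inj/enum_rank_inj-> /val_inj/enum_rank_inj->].
- by move=> [e _]; have := en_lt u; rewrite e ltnn.
- split; first exact: (subsetP BG).
  by rewrite mem_cat; apply/orP; left; apply/mapP; exists (u, v); rewrite ?mem_enum.
Qed.

(** A minimizer of [w(B) - |B| M] has maximum cardinality by [weight_diff], and between branchings
    of equal cardinality the multiples of [M] cancel. *)
Lemma optimal_real_arcs F : full_sol n col F ->
  (forall F', full_sol n col F' -> cost W F <= cost W F')%R ->
  min_weight_max_matroid_branching (arcs G) w color (real_arcs F).
Proof.
move=> hF opt; have br := real_arcs_branching hF.
set B := real_arcs F in br *.
have M0 : (0 < M)%R.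
  by apply: le_lt_trans big_weight_gt; apply: mulr_ge0 => //; apply: sumr_ge0.
have key B' : matroid_branching (arcs G) color B' ->
    (weight w B - #|B|%:R * M <= weight w B' - #|B'|%:R * M)%R.
  move=> /branching_full_sol[F' hF' <-]; have := opt F' hF'.
  by rewrite !cost_full // (size_full hF' hF) lerD2r.
have maxB B' : matroid_branching (arcs G) color B' -> #|B'| <= #|B|.
  move=> hB'; rewrite leqNgt; apply/negP => lt.
  have sB : B \subset arcs G by case: br => -[].
  have sB' : B' \subset arcs G by case: hB' => -[].
  have := key B' hB'; have := weight_diff sB' sB.
  have : (#|B|%:R + 1 <= #|B'|%:R :> R)%R by rewrite natr1 ler_nat.
  move: M M0 (#|B|%:R)%R (#|B'|%:R)%R (weight w B) (weight w B') => M' M0' x y a b; nra.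
split=> // B' [hB' maxB']; have e : #|B'| = #|B|.
  by apply/eqP; rewrite eqn_leq maxB // maxB'.
by have := key B' hB'; rewrite e lerD2r.
Qed.

End Translation.

Theorem theorem5 :
  exists (p : program) (C : nat),
  forall (R : realType) (G0 : digraph) (w : node G0 * node G0 -> R)
    (color : node G0 -> nat),
  exists (t : nat) (st : state R),
    exec p (input w color) t st /\
    min_weight_max_matroid_branching (arcs G0) w color (output G0 st) /\
    t <= C * #|node (augment G0)| ^ 2.
Proof.
exists branching_program, (80 * 100) => R G0 w color.
have [|x i j|x i j|t [st [ex [lt [F [hF opt out]]]]]] :=
  @program_spec R #|node G0| (input w color) _ _ _ (full_weight_ge0 w color).
- by [].
- by case: x => [|[|[|x]]].
- by case: x.
exists t, st; split=> //; split; last by rewrite /= card_option.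
have -> : output G0 st = real_arcs G0 F.
  apply/setP => -[u v]; rewrite !inE out ?ltn_ord //.
  by rewrite -(adj_en w color) andbC.
exact: optimal_real_arcs opt.
Qed.
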